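(* Let $0<a<b$ be reals, $n\in\mathbb{N}$, let $\alpha_0<\alpha_1<\dots<\alpha_n$ be real numbers, and let $\mathcal{F}=\{x^{\alpha_i}\}_{i=0}^n$. Then for any $f=\sum_{i=0}^n a_i x^{\alpha_i}\in\operatorname{lin}\mathcal{F}$ with $f>0$ on $[a,b]$ and $a_n>0$ there exists a unique decomposition $$f=f_*+f^*$$ with $f_*,f^*\in\operatorname{lin}\mathcal{F}$ such that (i) for $n=2m$ there exist points $x_1,\dots,x_m,y_1,\dots,y_{m-1}\in[a,b]$ with $a<x_1<y_1<\dots<y_{m-1}<x_m<b$ and constants $c_*,c^*>0$ with $$f_*(x)=c_*\cdot\det\begin{pmatrix} x^{\alpha_0}&x^{\alpha_1}&x^{\alpha_2}&\dots&x^{\alpha_{2m-1}}&x^{\alpha_{2m}}\\ x&(x_1&x_1)&\dots&(x_m&x_m)\end{pmatrix}\ge 0$$ and $$f^*(x)=-c^*\cdot\det\begin{pmatrix} x^{\alpha_0}&x^{\alpha_1}&x^{\alpha_2}&x^{\alpha_3}&\dots&x^{\alpha_{2m-2}}&x^{\alpha_{2m-1}}&x^{\alpha_{2m}}\\ x&a&(y_1&y_1)&\dots&(y_{m-1}&y_{m-1})&b\end{pmatrix}\ge 0$$ for all $x\in[a,b]$; or (ii) for $n=2m+1$ there exist points $x_1,\dots,x_m,y_1,\dots,y_m\in[a,b]$ with $a<y_1<x_1<\dots<y_m<x_m<b$ and constants $c_*,c^*>0$ with $$f_*(x)=-c_*\cdot\det\begin{pmatrix} x^{\alpha_0}&x^{\alpha_1}&x^{\alpha_2}&x^{\alpha_3}&\dots&x^{\alpha_{2m}}&x^{\alpha_{2m+1}}\\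 x&a&(x_1&x_1)&\dots&(x_m&x_m)\end{pmatrix}\ge 0$$ and $$f^*(x)=c^*\cdot\det\begin{pmatrix} x^{\alpha_0}&x^{\alpha_1}&x^{\alpha_2}&\dots&x^{\alpha_{2m-1}}&x^{\alpha_{2m}}&x^{\alpha_{2m+1}}\\ x&(y_1&y_1)&\dots&(y_m&y_m)&b\end{pmatrix}\ge 0$$ for all $x\in[a,b]$.
   Context: $\operatorname{lin}\mathcal{F}$ is the real vector space of finite linear combinations of the functions in $\mathcal{F}$. Matrix notation: for functions $g_0,\dots,g_n$ and points $z_0,\dots,z_n$, $\begin{pmatrix} g_0&\dots&g_n\\ z_0&\dots&z_n\end{pmatrix}$ denotes the $(n+1)\times(n+1)$ matrix whose row belonging to the point $z_k$ is $(g_0(z_k),\dots,g_n(z_k))$. A bracketed pair $(z\ \ z)$ in the bottom line stands for two consecutive rows: $(g_0(z),\dots,g_n(z))$ followed by the row of derivatives $(g_0'(z),\dots,g_n'(z))$. In the top line $x^{\alpha_i}$ denotes the function $t\mapsto t^{\alpha_i}$; the bottom-line entry $x$ is the variable point at which $f_*$ or $f^*$ is evaluated. The uniqueness refers to decompositions with the stated properties. *)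

(* Defs.v *)
From HB Require Import structures.
From mathcomp Require Import all_boot all_order all_algebra.
From mathcomp Require Import all_classical all_reals all_analysis.

Set Implicit Arguments.
Unset Strict Implicit.
Unset Printing Implicit Defensive.

Import Order.TTheory GRing.Theory Num.Theory.
Import numFieldNormedType.Exports.

Local Open Scope classical_set_scope.
Local Open Scope ring_scope.

Section Defs.
Variable R : realType.

Definition lin (F : set (R -> R)) : set (R -> R) :=
  [set f | exists (k : nat) (g : 'I_k -> R -> R) (c : 'I_k -> R),
     (forall i, F (g i)) /\ f = (fun t => \sum_(i < k) c i * g i t)].

(* Only the values at t > 0 carry meaning, since powR is a convention for
   t <= 0; an element of the linear span of the monomials is determined by its
   restriction to any [a, b] with 0 < a < b. *)
Definition monomial n (alpha : 'I_n.+1 -> R) (i : 'I_n.+1) : R -> R :=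
  fun t => t `^ alpha i.

(* An entry of the bottom line of a matrix: [Single z] is a plain point z,
   [Double z] is a bracketed pair (z z). *)
Inductive node := Single of R | Double of R.

(* The rows contributed by a node; (d, z) stands for the row of the d-th
   derivatives at z. *)
Definition node_rows (p : node) : seq (nat * R) :=
  match p with
  | Single z => [:: (0%N, z)]
  | Double z => [:: (0%N, z); (1%N, z)]
  end.

(* Meant for bottom lines contributing exactly n.+1 rows, so that the default
   value of nth is never reached. *)
Definition node_mx n (g : 'I_n.+1 -> R -> R) (bottom : seq node) : 'M[R]_n.+1 :=
  \matrix_(k < n.+1, i < n.+1)
    let: (d, z) := nth (0%N, 0) (flatten (map node_rows bottom)) k in
    derive1n d (g i) z.

(* In both cases the points x_1, x_2, ... and y_1, y_2, ... are the values of
   x and y at the indices 1, 2, ...; all other values are irrelevant. *)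

(* The sorted list is a, x_1, y_1, x_2, y_2, ..., y_(m-1), x_m, b. *)
Definition even_form (a b : R) n (g : 'I_n.+1 -> R -> R) (m : nat)
    (fl fu : R -> R) : Prop :=
  exists (x y : nat -> R) (cl cu : R),
    [/\ sorted <%R
          ([:: a; x 1%N] ++ flatten [seq [:: y i; x i.+1] | i <- iota 1 m.-1]
             ++ [:: b]),
        0 < cl,
        0 < cu,
        forall t, t \in `[a, b] ->
          fl t = cl * \det (node_mx g
                   (Single t :: [seq Double (x i) | i <- iota 1 m]))
          /\ 0 <= fl t
      & forall t, t \in `[a, b] ->
          fu t = - cu * \det (node_mx g
                   ([:: Single t; Single a]
                      ++ [seq Double (y i) | i <- iota 1 m.-1]
                      ++ [:: Single b]))
          /\ 0 <= fu t].

(* The sorted list is a, y_1, x_1, y_2, x_2, ..., y_m, x_m, b. *)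
Definition odd_form (a b : R) n (g : 'I_n.+1 -> R -> R) (m : nat)
    (fl fu : R -> R) : Prop :=
  exists (x y : nat -> R) (cl cu : R),
    [/\ sorted <%R
          ([:: a] ++ flatten [seq [:: y i; x i] | i <- iota 1 m] ++ [:: b]),
        0 < cl,
        0 < cu,
        forall t, t \in `[a, b] ->
          fl t = - cl * \det (node_mx g
                   ([:: Single t; Single a]
                      ++ [seq Double (x i) | i <- iota 1 m]))
          /\ 0 <= fl t
      & forall t, t \in `[a, b] ->
          fu t = cu * \det (node_mx g
                   (Single t :: [seq Double (y i) | i <- iota 1 m]
                      ++ [:: Single b]))
          /\ 0 <= fu t].

End Defs.

(* Main.v *)
Require Import Defs.
From HB Require Import structures.
From mathcomp Require Import all_boot all_order all_algebra.
From mathcomp Require Import all_classical all_reals all_analysis.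
From mathcomp Require Import ring lra zify.

(** Among the functions g of the span with 0 <= g <= f on [a, b], the summand
f_* is the one whose coefficient of the top power x^alpha_n is largest.  Both
existence and uniqueness come from this extremal description.

Everything rests on one fact: a combination of n real powers that is not
identically zero has fewer than n zeros on the positive half-line, double zeros
counted twice (zero_count; divide by the lowest power and apply Rolle).
Together with the behaviour at infinity this makes the generalized Vandermonde
determinants, with single and double nodes listed in increasing order, positive
(det_rows_gt0).

Existence.  The set of admissible g is compact, so a maximizer g exists
(exists_max_top).  Let A and B be the closed sets where g = f and where g = 0;
they are disjoint since f > 0.  Either there are n + 1 points u_0 > ... > u_n
lying alternately in A and B with u_0 in A, or n points separate A from B with
the right parities (alternation_or_separation).  In the second case the
function vanishing at those n points, with positive top coefficient, is
negative on A and positive on B; adding a small multiple of it to g keeps g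
admissible and raises the top coefficient, a contradiction.  So g touches f and
0 alternately at n + 1 points (exists_alternation).  As g and f - g are
nonnegative, their interior zeros are double; counting zeros forces u_0 = b and
u_n = a (nonneg_zeros_le), and a function with n prescribed zeros is a multiple
of the corresponding determinant (node_repr).  The signs of the constants are
those of the top coefficients: the one of g is nonnegative because 0 is
admissible, the one of f - g is nonpositive because f is admissible, and neither
vanishes by the zero count.

Uniqueness.  In any decomposition of the required shape f_* alternates between
f and 0 at n + 1 points.  By Cramer's rule the top coefficient of h - f_*, for
admissible h, is a combination with coefficients of alternating signs of its
values there, hence nonpositive, and zero only if h = f_*
(alternating_unique).  Applied to the maximizer h this gives h = f_*. *)

Set Implicit Arguments.
Unset Strict Implicit.
Unset Printing Implicit Defensive.

Import Order.TTheory GRing.Theory Num.Theory.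
Import numFieldNormedType.Exports.

Local Open Scope classical_set_scope.
Local Open Scope ring_scope.

(** * Zeros of combinations of real powers *)

(** A row is encoded as (d, z), d = 0 for values and d = 1 for first derivatives
at z.  Derivatives are written by the power rule, so that the linear algebra
below never meets a limit. *)
Definition row_entry (R : realType) (alpha : nat -> R) (p : nat * R) (i : nat) : R :=
  if p.1 is 0%N then p.2 `^ alpha i else alpha i * p.2 `^ (alpha i - 1).

Definition row_eval (R : realType) n (alpha c : nat -> R) (p : nat * R) : R :=
  \sum_(i < n) c i * row_entry alpha p i.

Definition increasing_upto (R : realType) n (alpha : nat -> R) :=
  forall i j, (i < j)%N -> (j < n)%N -> alpha i < alpha j.

Definition rows (R : realType) (s : seq (node R)) := flatten (map (@node_rows R) s).

Definition node_pos (R : realType) (p : node R) : R :=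
  match p with Single z => z | Double z => z end.

Lemma is_derive_row_eval (R : realType) n (alpha c : nat -> R) (t : R) : 0 < t ->
  is_derive t 1 (fun x => row_eval n alpha c (0%N, x)) (row_eval n alpha c (1%N, t)).
Proof.
move=> t0; rewrite /row_eval.
have -> : (fun x => \sum_(i < n) c i * row_entry alpha (0%N, x) i) =
   \sum_(i < n) (c i \*: (fun x : R => x `^ alpha i)).
  by apply/funext => x; rewrite fct_sumE.
apply: is_derive_sum => i.
by apply: is_deriveZ; apply: is_derive1_powR.
Qed.

Lemma continuous_row_eval (R : realType) n (alpha c : nat -> R) (x y : R) : 0 < x ->
  {within `[x, y], continuous (fun t => row_eval n alpha c (0%N, t))}.
Proof.
move=> x0; apply: derivable_within_continuous => t; rewrite in_itv /= => /andP[xt _].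
have t0 : 0 < t by apply: lt_le_trans xt.
by have [] := is_derive_row_eval n alpha c t0.
Qed.

Lemma rows_cons (R : realType) (p : node R) s : rows (p :: s) = node_rows p ++ rows s.
Proof. by []. Qed.

Lemma node_pos_row (R : realType) (p : node R) : (0%N, node_pos p) \in node_rows p.
Proof. by case: p => z; rewrite inE eqxx. Qed.

Lemma rows_double (R : realType) (s : seq (node R)) z :
  (1%N, z) \in rows s -> (0%N, z) \in rows s.
Proof.
elim: s => // x s IH; rewrite rows_cons !mem_cat => /orP[|/IH->]; last by rewrite orbT.
by case: x => u /=; rewrite !inE ?xpair_eqE //= => ->.
Qed.

(** Rolle's theorem yields a zero of q' strictly between consecutive nodes, and a
double node contributes one more at the node itself; so k zeros of q, counted
with multiplicity, leave k - 1 distinct zeros of q'.  The bound l on the left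
is what lets the induction concatenate the zeros found in successive gaps. *)
Lemma rolle_nodes (R : realType) (q q' : R -> R) (s : seq (node R)) (l : R) :
  0 <= l -> path <%R l (map (@node_pos R) s) ->
  (forall t : R, 0 < t -> is_derive t 1 q (q' t)) ->
  (forall z, (0%N, z) \in rows s -> q z = 0) ->
  (forall z, (1%N, z) \in rows s -> q' z = 0) ->
  exists w, [/\ path <%R l w, size w = (size (rows s)).-1 &
     forall z, z \in w -> q' z = 0].
Proof.
move=> l0 ls dq; elim: s l l0 ls => [|x s IH] l l0 ls h0 h1.
  by exists [::]; split.
(* the zero contributed by the first node itself, if it is double *)
have dble : exists w, [/\ path <%R l w, size w = (size (node_rows x)).-1,
    forall z, z \in w -> q' z = 0 & last l w <= node_pos x].
  move: ls h1; rewrite rows_cons; case: x {h0} => z /= /andP[lz _] h1.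
    by exists [::]; split=> //=; exact: ltW.
  exists [:: z]; split; rewrite /= ?lz ?lexx // => u; rewrite inE => /eqP ->.
  by apply: h1; rewrite /= !inE eqxx ?orbT.
have [w1 [pw1 sw1 zw1 lw1]] := dble.
case: s IH ls h0 h1 => [|y s] IH ls h0 h1.
  by exists w1; split=> //; rewrite sw1 rows_cons cats0.
move: ls => /= /and3P[lx xy ys].
have x0 : 0 < node_pos x by apply: le_lt_trans l0 lx.
have [u uxy du] : exists2 u, u \in `](node_pos x), (node_pos y)[ & is_derive u 1 q 0.
  apply: Rolle => //.
  - move=> t; rewrite in_itv /= => /andP[xt _].
    by have [] := dq t (lt_trans x0 xt).
  - apply: derivable_within_continuous => t; rewrite in_itv /= => /andP[xt _].
    by have [] := dq t (lt_le_trans x0 xt).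
  - rewrite !h0 //; rewrite !rows_cons !mem_cat node_pos_row ?orbT //.
move: uxy; rewrite in_itv /= => /andP[xu uy].
have [||||w [pw sw zw]] := IH u.
- by apply: ltW; apply: lt_trans xu.
- by rewrite /= uy.
- by move=> z zs; apply: h0; rewrite rows_cons mem_cat zs orbT.
- by move=> z zs; apply: h1; rewrite rows_cons mem_cat zs orbT.
exists (w1 ++ u :: w); split.
- rewrite cat_path pw1 /= pw andbT; exact: le_lt_trans lw1 xu.
- rewrite size_cat /= sw sw1 rows_cons size_cat.
  by case: (x) => ?; case: (y) => ? /=; rewrite ?addnS ?addSn ?add0n.
- move=> z; rewrite mem_cat inE => /or3P[/zw1//|/eqP->|/zw//].
  have d1 := dq u (lt_trans x0 xu).
  by rewrite -(@derive_val _ _ _ _ _ _ _ d1) (@derive_val _ _ _ _ _ _ _ du).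
Qed.

Lemma path_lt (R : realType) (l : R) s : path <%R l s -> forall z, z \in s -> l < z.
Proof. by move/(order_path_min lt_trans)/allP. Qed.

Lemma rows_pos (R : realType) (s : seq (node R)) p :
  p \in rows s -> p.2 \in map (@node_pos R) s.
Proof.
elim: s => // x s IH; rewrite rows_cons mem_cat => /orP[|/IH h].
  by case: x => z /=; rewrite !inE; [move/eqP->|case/orP=> /eqP->]; rewrite /= eqxx.
by rewrite /= inE h orbT.
Qed.

Lemma rows_Single (R : realType) (w : seq R) :
  rows (map (@Single R) w) = map (pair 0%N) w.
Proof. by elim: w => // x w IH; rewrite /= rows_cons IH. Qed.

Lemma node_pos_Single (R : realType) (w : seq R) : map (@node_pos R) (map (@Single R) w) = w.
Proof. by rewrite -map_comp map_id. Qed.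

(** Dividing by the lowest power makes the first term constant, and
differentiating removes it: one term fewer, and by Rolle at most one zero fewer.
The zeros that remain are simple, but the induction has to admit double ones
since it starts from them. *)
Lemma zero_count (R : realType) n (alpha c : nat -> R) (s : seq (node R)) :
  increasing_upto n alpha -> path <%R 0 (map (@node_pos R) s) -> (n <= size (rows s))%N ->
  (forall p, p \in rows s -> row_eval n alpha c p = 0) ->
  forall i, (i < n)%N -> c i = 0.
Proof.
elim: n alpha c s => // n IH alpha c s inc ps ss hz.
have spos p : p \in rows s -> 0 < p.2 by move/rows_pos/(path_lt ps).
(* t^(- alpha 0) times the given combination has exponents be; its derivative is
   a combination of n powers with coefficients ce *)
pose be i := alpha i - alpha 0%N.
pose ce i := c i.+1 * be i.+1.
have evE t : 0 < t -> row_eval n.+1 be c (0%N, t) = t `^ (- alpha 0%N) * row_eval n.+1 alpha c (0%N, t).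
  move=> t0; rewrite /row_eval mulr_sumr; apply: eq_bigr => i _.
  rewrite /row_entry /= /be addrC powRD; last by rewrite (gt_eqF t0) implybT.
  by rewrite mulrCA.
have evE' t : 0 < t -> row_eval n.+1 be c (1%N, t) = t `^ (- alpha 0%N) * row_eval n.+1 alpha c (1%N, t)
     - alpha 0%N * t `^ (- alpha 0%N - 1) * row_eval n.+1 alpha c (0%N, t).
  move=> t0; rewrite /row_eval !mulr_sumr -sumrB; apply: eq_bigr => i _.
  rewrite /row_entry /= /be.
  have nz : t != 0 by rewrite gt_eqF.
  have -> : alpha i - alpha 0%N - 1 = alpha i + (- alpha 0%N - 1) by ring.
  rewrite !powRD ?nz ?implybT //; ring.
have evS t : row_eval n.+1 be c (1%N, t) = row_eval n (fun i => be i.+1 - 1) ce (0%N, t).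
  rewrite /row_eval big_ord_recl /= /row_entry /= {1 2}/be subrr mul0r mulr0 add0r.
  by apply: eq_bigr => i _; rewrite /ce mulrA.
have [||w [pw sw zw]] := rolle_nodes (lexx 0) ps (is_derive_row_eval n.+1 be c).
- by move=> z z0; rewrite evE ?(spos _ z0) // hz // mulr0.
- move=> z z1; rewrite evE' ?(spos _ z1) // hz // mulr0 hz ?mulr0 ?subrr //.
  exact: rows_double.
have cS i : (i < n)%N -> c i.+1 = 0.
  move=> ilt.
  have : ce i = 0.
    apply: (IH (fun i => be i.+1 - 1) ce (map (@Single R) w)) => //.
    - by move=> j k jk kn; rewrite ltrD2r /be ltrD2r inc.
    - by rewrite node_pos_Single.
    - by rewrite rows_Single size_map sw -ltnS (ltn_predK ss).
    - move=> p; rewrite rows_Single => /mapP[z zin ->].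
      by rewrite -evS zw.
  move=> /eqP; rewrite mulf_eq0 => /orP[/eqP//|].
  by rewrite /be subr_eq0 gt_eqF // inc.
case=> [_|i]; last exact: cS.
case: s ps ss hz spos {pw sw zw} => // x s ps ss hz spos.
have xin : (0%N, node_pos x) \in rows (x :: s) by rewrite rows_cons mem_cat node_pos_row.
have := hz _ xin.
rewrite /row_eval big_ord_recl big1 ?addr0; last by move=> i _; rewrite cS ?mul0r.
move/eqP; rewrite mulf_eq0 => /orP[/eqP//|].
rewrite /row_entry /=.
by rewrite (gt_eqF (powR_gt0 _ (spos _ xin))).
Qed.

(** * Positivity of generalized Vandermonde determinants *)

Definition rows_mx (R : realType) n (alpha : nat -> R) (rs : seq (nat * R)) : 'M[R]_n :=
  \matrix_(k < n, i < n) row_entry alpha (nth (0%N, 0) rs k) i.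

Definition insert_at (T : Type) j (p : T) rs := take j rs ++ p :: drop j rs.

(** The coefficients of the combination of powers obtained by expanding, along its
first row, the determinant whose other rows are rs. *)
Definition expansion_coef (R : realType) n (alpha : nat -> R) (rs : seq (nat * R)) (i : nat) : R :=
  (-1) ^+ i * \det (\matrix_(k < n, l < n) row_entry alpha (nth (0%N, 0) rs k) (bump i l)).

Lemma nth_insert (T : Type) (x0 p : T) rs j : (j <= size rs)%N ->
  nth x0 (insert_at j p rs) j = p /\ forall k, nth x0 (insert_at j p rs) (bump j k) = nth x0 rs k.
Proof.
move=> js; have st : size (take j rs) = j by rewrite size_takel.
split; first by rewrite nth_cat st ltnn subnn.
move=> k; rewrite nth_cat st /bump; case: (leqP j k) => jk /=.
  by rewrite add1n ltnNge (leqW jk) /= subSn //= nth_drop subnKC.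
by rewrite add0n jk nth_take.
Qed.

(** The minors along the inserted row do not depend on its position, which
therefore only affects the sign. *)
Lemma det_insert (R : realType) n (alpha : nat -> R) rs p j : size rs = n -> (j <= n)%N ->
  \det (rows_mx n.+1 alpha (insert_at j p rs)) = (-1) ^+ j * row_eval n.+1 alpha (expansion_coef n alpha rs) p.
Proof.
move=> sn jn; have js : (j <= size rs)%N by rewrite sn.
have [nj nk] := nth_insert (0%N, 0) p js.
have jlt : (j < n.+1)%N by [].
rewrite (expand_det_row _ (Ordinal jlt)) /row_eval mulr_sumr; apply: eq_bigr => i _.
rewrite mxE /= nj /cofactor /expansion_coef /= exprD.
set A := row' _ _; set B := \matrix_(k, l) _.
have -> : A = B by apply/matrixP => k l; rewrite !mxE /= nk.
ring.
Qed.

Lemma expansion_coef_top (R : realType) n (alpha : nat -> R) rs :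
  expansion_coef n alpha rs n = (-1) ^+ n * \det (rows_mx n alpha rs).
Proof.
rewrite /expansion_coef; congr (_ * \det _); apply/matrixP => k l.
by rewrite !mxE /bump leqNgt ltn_ord.
Qed.

Lemma row_eval_expansion_mem (R : realType) n (alpha : nat -> R) rs p : size rs = n -> p \in rs ->
  row_eval n.+1 alpha (expansion_coef n alpha rs) p = 0.
Proof.
move=> sn pin; have := det_insert alpha p sn (leq0n _).
rewrite expr0 mul1r => <-; rewrite /insert_at take0 drop0 /=.
have hi : ((index p rs).+1 < n.+1)%N by rewrite ltnS -sn index_mem.
apply: (@determinant_alternate _ _ _ ord0 (Ordinal hi)) => // i.
by rewrite !mxE /= nth_index.
Qed.

Lemma row_eval_rows_mx (R : realType) n (alpha c : nat -> R) rs (k : 'I_n) :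
  (rows_mx n alpha rs *m (\col_i c i)) k 0 = row_eval n alpha c (nth (0%N, 0) rs k).
Proof. by rewrite mxE; apply: eq_bigr => i _; rewrite !mxE mulrC. Qed.

Lemma det_rows_neq0 (R : realType) n (alpha : nat -> R) (s : seq (node R)) :
  increasing_upto n alpha -> path <%R 0 (map (@node_pos R) s) -> size (rows s) = n ->
  \det (rows_mx n alpha (rows s)) != 0.
Proof.
move=> inc ps ss; rewrite -det_tr; apply/negP => /det0P[v vn0 hv].
case: n alpha inc ss v vn0 hv => [|n] alpha inc ss v vn0 hv.
  by move/eqP: vn0; apply; apply/rowP; case.
pose c i := v 0 (inord i).
have vE : v^T = \col_i c i by apply/colP => i; rewrite !mxE /c inord_val.
have hc : rows_mx n.+1 alpha (rows s) *m (\col_i c i) = 0.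
  by rewrite -vE -[LHS]trmxK trmx_mul trmxK hv trmx0.
move/eqP: vn0; apply; apply/rowP => i; rewrite mxE.
have <- : c i = v 0 i by rewrite /c inord_val.
apply: (zero_count inc ps) => // [|p pin]; first by rewrite ss.
have hi : (index p (rows s) < n.+1)%N by rewrite -ss index_mem.
by have := row_eval_rows_mx alpha c (rows s) (Ordinal hi); rewrite hc mxE /= nth_index.
Qed.

Lemma powR_small (R : realType) (e h : R) : 0 < e -> 0 < h ->
  exists T, forall t : R, 0 < t -> T <= t -> t `^ (- e) <= h.
Proof.
move=> e0 h0; exists (h `^ (- e^-1)) => t t0 ht.
have en0 : e != 0 by rewrite gt_eqF.
have : (h `^ (- e^-1)) `^ e <= t `^ e by apply: ge0_ler_powR; rewrite ?nnegrE ?powR_ge0 // ltW.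
rewrite -powRrM mulNr mulVf // !powRN powRr1 ?(ltW h0) //.
by rewrite invf_ple ?posrE ?powR_gt0.
Qed.

(** The top power dominates at infinity. *)
Lemma row_eval_large (R : realType) n (alpha c : nat -> R) (T : R) :
  increasing_upto n.+1 alpha -> 0 < c n ->
  exists t, [/\ T <= t, 0 < t & 0 < row_eval n.+1 alpha c (0%N, t)].
Proof.
move=> inc cn.
have small k : (k <= n)%N -> forall h, 0 < h -> exists S, forall t : R, 0 < t -> S <= t ->
    `|\sum_(i < k) c i * t `^ (alpha i - alpha n)| <= h.
  elim: k => [|k IH] kn h h0.
    by exists 0 => t _ _; rewrite big_ord0 normr0 ltW.
  have h20 : 0 < h / 2 by rewrite divr_gt0.
  have [S1 HS1] := IH (ltnW kn) _ h20.
  have ck0 : 0 < `|c k| + 1 by rewrite ltr_wpDl.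
  have [|S2 HS2] := @powR_small _ (alpha n - alpha k) _ _ (divr_gt0 h20 ck0).
    by rewrite subr_gt0 inc.
  exists (Num.max S1 S2) => t t0; rewrite ge_max => /andP[St1 St2].
  rewrite big_ord_recr /=; apply: le_trans (ler_normD _ _) _.
  rewrite [leRHS]splitr lerD ?HS1 // normrM (ger0_norm (powR_ge0 _ _)).
  have := HS2 t t0 St2; rewrite opprB ler_pdivlMr // => H.
  by apply: le_trans H; rewrite mulrDr mulr1 mulrC lerDl powR_ge0.
have [S HS] := small n (leqnn _) (c n / 2) (divr_gt0 cn (ltr0Sn _ 1)).
pose t := Num.max 1 (Num.max S T); exists t.
have t0 : 0 < t by rewrite lt_max ltr01.
split=> //; first by rewrite !le_max lexx !orbT.
have /HS : S <= t by rewrite !le_max lexx !orbT.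
move=> /(_ t0) hs.
have -> : row_eval n.+1 alpha c (0%N, t) = t `^ alpha n * (\sum_(i < n.+1) c i * t `^ (alpha i - alpha n)).
  rewrite mulr_sumr; apply: eq_bigr => i _; rewrite /row_entry /= mulrCA -powRD ?(gt_eqF t0) ?implybT //.
  by rewrite subrKC.
rewrite mulr_gt0 ?powR_gt0 // big_ord_recr /= subrr powRr0 mulr1.
by move: hs; rewrite ler_norml => /andP[hs _]; lra.
Qed.

(** With n zeros already accounted for, there is none further to the right, so the
sign there is that of the top coefficient, seen at infinity. *)
Lemma row_eval_gt0_right (R : realType) n (alpha c : nat -> R) (s : seq (node R)) (t : R) :
  increasing_upto n.+1 alpha -> path <%R 0 (rcons (map (@node_pos R) s) t) -> size (rows s) = n ->
  (forall p, p \in rows s -> row_eval n.+1 alpha c p = 0) -> 0 < c n ->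
  0 < row_eval n.+1 alpha c (0%N, t).
Proof.
move=> inc ps ss hz cn.
have t0 : 0 < t by apply: (path_lt ps); rewrite mem_rcons inE eqxx.
rewrite ltNge; apply/negP => le0.
have [u [tu u0 evu]] := row_eval_large t inc cn.
have [v] : exists2 v, v \in `[t, u] & row_eval n.+1 alpha c (0%N, v) = 0.
  apply: (@IVT _ (fun x => row_eval n.+1 alpha c (0%N, x)) _ _ _ tu); first exact: continuous_row_eval.
  by rewrite ge_min le_max le0 (ltW evu) orbT.
rewrite in_itv /= => /andP[tv _] zv.
suff : c n = 0 by move/eqP; rewrite gt_eqF.
apply: (@zero_count _ n.+1 alpha c (rcons s (Single v))) => //.
- move: ps; rewrite map_rcons !rcons_path => /andP[-> /=] h; exact: lt_le_trans tv.
- by rewrite /rows map_rcons flatten_rcons size_cat -/(rows s) ss addn1.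
- by move=> p; rewrite /rows map_rcons flatten_rcons mem_cat inE => /orP[/hz//|/eqP->].
Qed.

Lemma rows_rcons (R : realType) (s : seq (node R)) p :
  rows (rcons s p) = rows s ++ node_rows p.
Proof. by rewrite /rows map_rcons flatten_rcons. Qed.

Lemma det_rcons (R : realType) n (alpha : nat -> R) rs p : size rs = n ->
  \det (rows_mx n.+1 alpha (rcons rs p)) = row_eval n.+1 alpha (fun i => (-1) ^+ n * expansion_coef n alpha rs i) p.
Proof.
move=> sn; have := det_insert alpha p sn (leqnn _).
rewrite /insert_at -sn take_size drop_size cats1 => ->.
by rewrite /row_eval mulr_sumr; apply: eq_bigr => i _; rewrite mulrA.
Qed.

Lemma right_derive_ge0 (R : realType) (q : R -> R) (z l : R) : is_derive z 1 q l -> q z = 0 ->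
  (forall t, z < t -> 0 < q t) -> 0 <= l.
Proof.
move=> [dq <-] qz qpos; rewrite /derive.
have c := cvg_dnbhs_at_right dq.
rewrite -(cvg_lim _ c) //.
apply: limr_ge; first by apply/cvg_ex; eexists; exact: c.
near=> h.
rewrite /= qz subr0 scaler1 mulr_ge0 ?invr_ge0 // ltW //.
by apply: qpos; rewrite ltrDr.
Unshelve. all: by end_near.
Qed.

(** Induction on the last row.  As a function of a last single node the determinant
vanishes at the preceding nodes, and its top coefficient is the smaller
determinant, positive by induction.  If the last node z is double, the
determinant is the derivative at z of a function that vanishes at z and is
positive to the right of z: it is nonnegative, and it is nonzero by the zero
count. *)
Lemma det_rows_gt0 (R : realType) n (alpha : nat -> R) (s : seq (node R)) :
  increasing_upto n alpha -> path <%R 0 (map (@node_pos R) s) -> size (rows s) = n ->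
  0 < \det (rows_mx n alpha (rows s)).
Proof.
elim: n s => [|n IH] s inc ps ss; first by rewrite det_mx00.
have inc' : increasing_upto n alpha by move=> i j ij jn; apply: inc => //; exact: leqW.
have single s' t : path <%R 0 (map (@node_pos R) (rcons s' (Single t))) -> size (rows s') = n ->
    0 < \det (rows_mx n.+1 alpha (rows (rcons s' (Single t)))).
  rewrite map_rcons /= => ps' ss'.
  rewrite rows_rcons cats1 det_rcons //.
  apply: (@row_eval_gt0_right _ n _ _ s') => //.
    move=> p pin; have := row_eval_expansion_mem alpha ss' pin; rewrite /row_eval => H.
    under eq_bigr => i _ do rewrite -mulrA.
    by rewrite -mulr_sumr H mulr0.
  rewrite expansion_coef_top signrMK.
  by apply: IH => //; move: ps'; rewrite rcons_path => /andP[].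
case/lastP: s ps ss => [|s p] //.
case: p => z ps ss; first by apply: single => //; move: ss; rewrite rows_rcons size_cat addn1 => -[].
rewrite lt_neqAle eq_sym det_rows_neq0 //=.
have ss' : size (rows (rcons s (Single z))) = n.
  by move: ss; rewrite !rows_rcons !size_cat addn2 addn1 => -[].
have -> : rows (rcons s (Double z)) = rcons (rows (rcons s (Single z))) (1%N, z).
  by rewrite !rows_rcons -cats1 -catA.
rewrite det_rcons //.
have z0 : 0 < z by apply: (path_lt ps); rewrite map_rcons mem_rcons inE eqxx.
have cf0 p : p \in rows (rcons s (Single z)) ->
    row_eval n.+1 alpha (fun i => (-1) ^+ n * expansion_coef n alpha (rows (rcons s (Single z))) i) p = 0.
  move=> pin; have := row_eval_expansion_mem alpha ss' pin; rewrite /row_eval => H.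
  under eq_bigr => i _ do rewrite -mulrA.
  by rewrite -mulr_sumr H mulr0.
apply: (right_derive_ge0 (is_derive_row_eval _ _ _ z0)) => [|t zt].
  by apply: cf0; rewrite rows_rcons mem_cat inE eqxx orbT.
rewrite -det_rcons // -cats1 -(rows_rcons (rcons s (Single z)) (Single t)).
apply: single => //; move: ps; rewrite !map_rcons /= !rcons_path last_rcons => /andP[-> ->] //.
Qed.

(** * Consequences of positivity *)

Lemma path_map_iota (R : realType) (u : nat -> R) l m :
  (forall i, (l <= i)%N -> (i.+1 < l + m)%N -> u i < u i.+1) ->
  (forall i, (l <= i < l + m)%N -> 0 < u i) ->
  path <%R 0 (map u (iota l m)).
Proof.
move=> inc u0; rewrite path_min_sorted; last first.
  by apply/allP => z /mapP[i]; rewrite mem_iota => /u0 h ->.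
apply/(sortedP 0) => i; rewrite size_map size_iota => im.
rewrite !(nth_map 0%N) ?size_iota ?nth_iota ?(ltnW im) // addnS.
by apply: inc; rewrite ?leq_addr // -addnS ltn_add2l.
Qed.

Lemma increasing_uptoW (R : realType) n (alpha : nat -> R) : increasing_upto n.+1 alpha -> increasing_upto n alpha.
Proof. by move=> inc i j ij jn; apply: inc => //; exact: leqW. Qed.

(** Subtracting the multiple of the determinant with the same top coefficient leaves
a combination of n powers with n zeros. *)
Lemma row_eval_det_repr (R : realType) n (alpha c : nat -> R) (s : seq (node R)) :
  increasing_upto n.+1 alpha -> path <%R 0 (map (@node_pos R) s) -> size (rows s) = n ->
  (forall p, p \in rows s -> row_eval n.+1 alpha c p = 0) ->
  forall p, row_eval n.+1 alpha c p =
    (-1) ^+ n * (c n / \det (rows_mx n alpha (rows s))) * \det (rows_mx n.+1 alpha (p :: rows s)).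
Proof.
move=> inc ps ss hz p.
have D0 := det_rows_gt0 (increasing_uptoW inc) ps ss.
set D := \det _ in D0 *.
pose g i := c i - c n / D * ((-1) ^+ n * expansion_coef n alpha (rows s) i).
have evg q : row_eval n.+1 alpha g q = row_eval n.+1 alpha c q
     - c n / D * ((-1) ^+ n * row_eval n.+1 alpha (expansion_coef n alpha (rows s)) q).
  by rewrite /row_eval !mulr_sumr -sumrB; apply: eq_bigr => i _; rewrite /g; ring.
have gn : g n = 0.
  by rewrite /g expansion_coef_top signrMK divfK ?subrr ?gt_eqF.
have g0 i : (i < n.+1)%N -> g i = 0.
  rewrite ltnS leq_eqVlt => /orP[/eqP->//|].
  apply: (zero_count (increasing_uptoW inc) ps) => [|q qin]; first by rewrite ss.
  have : row_eval n.+1 alpha g q = 0 by rewrite evg hz // row_eval_expansion_mem // !mulr0 subrr.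
  by rewrite /row_eval big_ord_recr /= gn mul0r addr0.
have : row_eval n.+1 alpha g p = 0 by rewrite /row_eval big1 // => i _; rewrite g0 ?mul0r.
have := det_insert alpha p ss (leq0n _); rewrite expr0 mul1r /insert_at take0 drop0 => ->.
by rewrite evg => /eqP; rewrite subr_eq0 => /eqP ->; ring.
Qed.

(** By Cramer's rule the top coefficient is a combination of the values at the t k
with cofactors of alternating signs.  Under the sign hypothesis all the terms
are nonpositive while their sum is not negative, so every value vanishes. *)
Lemma alternation_cramer (R : realType) n (alpha c : nat -> R) (t : nat -> R) :
  increasing_upto n.+1 alpha -> 0 < t 0%N -> (forall i, (i < n)%N -> t i < t i.+1) ->
  (forall k, (k <= n)%N -> (-1) ^+ (n + k) * row_eval n.+1 alpha c (0%N, t k) <= 0) ->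
  0 <= c n -> forall i, (i < n.+1)%N -> c i = 0.
Proof.
move=> inc t0 tS sg cn.
have tlt i j : (i < j)%N -> (j <= n)%N -> t i < t j.
  elim: j => // j IH; rewrite ltnS leq_eqVlt => /orP[/eqP->|ij] jn; first exact: tS.
  by apply: lt_trans (tS _ jn); apply: IH => //; exact: ltnW.
have tpos i : (i <= n)%N -> 0 < t i.
  by case: i => // i h; apply: lt_trans t0 (tlt _ _ _ h).
pose rs (u : nat -> R) m : seq (nat * R) := rows (map (@Single R) (map u (iota 0 m))).
have rsn u m k : (k < m)%N -> nth (0%N, 0) (rs u m) k = (0%N, u k).
  move=> km; rewrite /rs rows_Single (nth_map 0) ?size_map ?size_iota //.
  by rewrite (nth_map 0%N) ?size_iota // nth_iota.
have rss u m : size (rs u m) = m by rewrite /rs rows_Single !size_map size_iota.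
pose M := rows_mx n.+1 alpha (rs t n.+1).
have pT : path <%R 0 (map (@node_pos R) (map (@Single R) (map t (iota 0 n.+1)))).
  by rewrite node_pos_Single; apply: path_map_iota => i; [move=> _; apply: tS|apply: tpos].
have D0 : 0 < \det M by exact: det_rows_gt0 inc pT (rss t n.+1).
have adjpos (k : 'I_n.+1) : 0 < (-1) ^+ (n + k) * \adj M ord_max k.
  rewrite mxE /cofactor mulrA -exprD /= (addnC k) addnn -signr_odd odd_double expr0 mul1r.
  have -> : row' k (col' ord_max M) = rows_mx n alpha (rs (fun i => t (bump k i)) n).
    apply/matrixP => i j; rewrite !mxE !rsn //=.
      by rewrite (_ : bump n j = j) // /bump leqNgt ltn_ord.
    by rewrite /bump; case: (k <= i)%N; rewrite ?add1n ?add0n ltnS // ltnW.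
  apply: (det_rows_gt0 (increasing_uptoW inc) _ (rss _ _)).
  rewrite node_pos_Single; apply: path_map_iota => i; rewrite add0n => hi.
    by move=> hi'; apply: tlt; rewrite /bump; lia.
  by apply: tpos; rewrite /bump; lia.
have E : \det M * c n = \sum_(k < n.+1) \adj M ord_max k * row_eval n.+1 alpha c (0%N, t k).
  have : (\adj M *m (M *m (\col_i c i))) ord_max 0 = \det M * c n.
    by rewrite mulmxA mul_adj_mx mul_scalar_mx !mxE.
  move=> <-; rewrite mxE; apply: eq_bigr => k _; congr (_ * _).
  by rewrite row_eval_rows_mx rsn.
have le0 (k : 'I_n.+1) : 0 <= - (\adj M ord_max k * row_eval n.+1 alpha c (0%N, t k)).
  have kn : (k <= n)%N by rewrite -ltnS.
  have := mulr_ge0_le0 (ltW (adjpos k)) (sg k kn).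
  rewrite mulrACA -exprD addnn -signr_odd odd_double expr0 mul1r.
  by rewrite oppr_ge0.
have S0 : \sum_(k < n.+1) - (\adj M ord_max k * row_eval n.+1 alpha c (0%N, t k)) = 0.
  apply/eqP; rewrite eq_le sumr_ge0 ?andbT // sumrN -E oppr_le0 mulr_ge0 // ltW //.
have ev0 k : (k < n.+1)%N -> row_eval n.+1 alpha c (0%N, t k) = 0.
  move=> kn; have /eqP := S0; rewrite psumr_eq0 // => /allP /(_ (Ordinal kn)).
  rewrite mem_index_enum => /(_ isT); rewrite oppr_eq0 mulf_eq0 => /orP[/eqP h|/eqP //].
  by have := adjpos (Ordinal kn); rewrite h mulr0 ltxx.
apply: (zero_count inc pT).
  by have := rss t n.+1; rewrite /rs => ->.
move=> p /(nthP (0%N, 0))[k]; rewrite -/(rs t n.+1) rss => kn <-.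
by rewrite rsn // ev0.
Qed.

(** The function with the simple zeros zs, normalized to have a positive top
coefficient. *)
Definition zero_coef (R : realType) n (alpha : nat -> R) (zs : seq R) (i : nat) : R :=
  (-1) ^+ n * expansion_coef n alpha (rows (map (@Single R) zs)) i.

Lemma zero_coef_top (R : realType) n (alpha : nat -> R) zs :
  increasing_upto n.+1 alpha -> path <%R 0 zs -> size zs = n -> 0 < zero_coef n alpha zs n.
Proof.
move=> inc ps ss; rewrite /zero_coef expansion_coef_top signrMK.
by apply: det_rows_gt0; rewrite ?node_pos_Single ?rows_Single ?size_map //; exact: increasing_uptoW.
Qed.

(** The value at t is, up to the sign of moving its row to its place among the zeros,
a determinant with increasing nodes: the number of zeros to the right of t gives
the sign. *)
Lemma zero_coef_sign (R : realType) n (alpha : nat -> R) (zs : seq R) (t : R) :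
  increasing_upto n.+1 alpha -> path <%R 0 zs -> size zs = n -> 0 < t -> t \notin zs ->
  0 < (-1) ^+ (count (> t) zs) * row_eval n.+1 alpha (zero_coef n alpha zs) (0%N, t).
Proof.
move=> inc ps ss t0 tz.
have so := path_sorted ps.
pose z1 := [seq z <- zs | z < t]; pose z2 := [seq z <- zs | t < z].
have [p1 p2] : pairwise <%R z1 /\ pairwise <%R z2.
  by split; apply: pairwise_filter; rewrite -sorted_pairwise //; exact: lt_trans.
have p12 : allrel <%R z1 z2.
  apply/allrelP => x y; rewrite !mem_filter => /andP[xt _] /andP[ty _].
  exact: lt_trans ty.
have so12 : path <%R 0 (z1 ++ t :: z2).
  rewrite path_min_sorted; last first.
    apply/allP => z; rewrite mem_cat inE !mem_filter => /or3P[/andP[_]|/eqP->//|/andP[_]];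
    exact: (path_lt ps).
  rewrite sorted_pairwise; last exact: lt_trans.
  rewrite pairwise_cat p1 /= p2 allrel_consr p12 !filter_all //.
have zE : zs = z1 ++ z2.
  apply: lt_sorted_eq => //.
    by rewrite sorted_pairwise ?pairwise_cat ?p1 ?p2 ?p12 //; exact: lt_trans.
  move=> z; rewrite mem_cat !mem_filter; case: (ltgtP z t) => [_|_|->] /=; rewrite ?orbF //.
  exact/negbTE.
have ss' : size (rows (map (@Single R) zs)) = n by rewrite rows_Single !size_map.
have nE : n = (size z1 + size z2)%N by rewrite -ss {1}zE size_cat.
have jn : (size z1 <= n)%N by rewrite nE leq_addr.
have := det_insert alpha (0%N, t) ss' jn.
have -> : insert_at (size z1) (0%N, t) (rows (map (@Single R) zs)) =
    rows (map (@Single R) (z1 ++ t :: z2)).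
  rewrite !rows_Single /insert_at {1 2}zE !map_cat /= take_cat drop_cat !size_map ltnn subnn take0 drop0.
  by rewrite cats0.
move=> dE.
have : 0 < \det (rows_mx n.+1 alpha (rows (map (@Single R) (z1 ++ t :: z2)))).
  apply: det_rows_gt0; rewrite ?node_pos_Single ?rows_Single // size_map size_cat /= addnS.
  by rewrite nE.
rewrite dE -size_filter -/z2.
suff -> : row_eval n.+1 alpha (zero_coef n alpha zs) (0%N, t) =
    (-1) ^+ n * row_eval n.+1 alpha (expansion_coef n alpha (rows (map (@Single R) zs))) (0%N, t).
  by rewrite mulrA -exprD nE -(signr_odd _ (_ + _)%N) !oddD addbC -addbA addbb addbF signr_odd.
by rewrite /row_eval mulr_sumr; apply: eq_bigr => i _; rewrite /zero_coef -mulrA.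
Qed.

(** Greedy search from the right.  If A is not empty, let s be its maximum; the
alternation of B to the left of s and A, if long enough, is extended by s, and
otherwise the separating points found to the left of s are completed by one point
just after s, before the next point of B.  If A is empty, all the points are put
to the left of both sets.  The bound r keeps the points of the recursive
call to the left of s. *)
Lemma alternation_or_separation (R : realType) (k : nat) (A B : set R) (lo r : R) :
  0 < lo -> 0 < r -> closed A -> closed B -> A `&` B = set0 ->
  (forall t, A t -> lo <= t) -> (forall t, B t -> lo <= t) -> (forall t, A t -> t < r) ->
  (exists u : nat -> R, (forall i, (i < k)%N -> u i.+1 < u i) /\
     forall i, (i <= k)%N -> if odd i then B (u i) else A (u i)) \/
  (exists zs, [/\ size zs = k, path <%R 0 zs, (forall z, z \in zs -> z < r),
     (forall t, A t -> t \notin zs /\ odd (count (> t) zs)) &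
     (forall t, B t -> t \notin zs /\ ~~ odd (count (> t) zs))]).
Proof.
move=> lo0; elim: k A B r => [|k IH] A B r r0 cA cB AB lA lB Ar;
  have [[a0 Aa0]|/set0P/negP/negbNE/eqP A0] := pselect (A !=set0).
- by left; exists (fun _ => a0); split=> // i; rewrite leqn0 => /eqP ->.
- by right; exists [::]; split=> //; rewrite A0.
- have sA : A (sup A).
    rewrite {1}((closure_id A).1 cA); apply: closure_sup; first by exists a0.
    by exists r => t /Ar /ltW.
  set s := sup A in sA.
  have s0 : 0 < s by apply: lt_le_trans lo0 (lA _ sA).
  have As t : A t -> t <= s.
    by move=> At; apply: ub_le_sup => //; exists r => x /Ar /ltW.
  have nBs : ~ B s by move=> Bs; have : (A `&` B) s by []; rewrite AB.
  pose B' := B `&` [set t | t <= s].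
  have B's t : B' t -> t < s.
    by move=> [Bt /=]; rewrite le_eqVlt => /orP[/eqP ts|//]; rewrite ts in Bt.
  have := IH B' A s s0.
  case=> //.
  + by apply: closedI => //; exact: closed_le.
  + by apply/seteqP; split=> // t [[Bt _] At]; have : (A `&` B) t by []; rewrite AB.
  + by move=> t [Bt _]; exact: lB.
  + move=> [u [u1 u2]]; left; exists (fun i => if i is j.+1 then u j else s); split.
      case=> [_|i]; last exact: u1.
      by apply: B's; exact: (u2 0%N).
    case=> // i ik; have := u2 i ik => /=; case: (odd i) => //= -[] //.
  + move=> [zs [zk zp zlt zA zB]]; right.
    have [e e0 he] : exists2 e, 0 < e & forall t, `|s - t| < e -> ~ B t.
      have : nbhs s (~` B) by apply: open_nbhs_nbhs; split=> //; exact: closed_openC.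
      by move=> /nbhs_ballP[e /= e0 he]; exists e => // t ht; apply: he.
    have rs := Ar _ sA.
    (* the new point s + d stays below r and before the next point of B *)
    pose d := Num.min e (r - s) / 2.
    have m0 : 0 < Num.min e (r - s) by rewrite lt_min e0 subr_gt0.
    have d0 : 0 < d by rewrite divr_gt0.
    have [de dr] : d < e /\ d < r - s.
      have : d < Num.min e (r - s) by rewrite /d; lra.
      by rewrite lt_min => /andP[].
    have far t : B t -> s < t -> s + d < t.
      move=> Bt st; rewrite ltNge; apply/negP => tsd; apply: (he t) => //.
      rewrite ltr0_norm; lra.
    exists (rcons zs (s + d)); split.
    * by rewrite size_rcons zk.
    * rewrite rcons_path zp /=.
      have /predU1P[->|/zlt h] := mem_last 0 zs; lra.
    * by move=> z; rewrite mem_rcons inE => /orP[/eqP->|/zlt]; lra.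
    * move=> t At; have [h1 h2] := zB _ At; have ts := As _ At.
      rewrite mem_rcons inE negb_or h1 andbT -cats1 count_cat /= addn0.
      have tsd : t < s + d by lra.
      by rewrite tsd addn1 /= h2 lt_eqF.
    * move=> t Bt; rewrite mem_rcons inE negb_or -cats1 count_cat /= addn0.
      have [ts|st] := leP t s.
        have [h1 h2] := zA _ (conj Bt ts : B' t).
        have tsd : t < s + d by lra.
        by rewrite tsd h1 addn1 /= h2 lt_eqF.
      have tsd := far _ Bt st.
      have zst z : z \in zs -> z < t by move/zlt; lra.
      rewrite (gt_eqF tsd) /= (_ : count _ zs = 0%N); last first.
        by apply/eqP; rewrite -leqn0 leqNgt -has_count; apply/hasPn => z /zst; rewrite -leNgt => /ltW.
      rewrite ltNge (ltW tsd) /=; split=> //.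
      by apply/negP => /zst; rewrite ltxx.
(* k + 1 equally spaced points in the open interval between 0 and m *)
- right; pose m := Num.min lo r; have m0 : 0 < m by rewrite lt_min lo0.
  pose zs := map (fun i : nat => m * (i.+1%:R / k.+2%:R)) (iota 0 k.+1).
  have zlt z : z \in zs -> z < m.
    move=> /mapP[i]; rewrite mem_iota add0n => ik ->.
    by rewrite gtr_pMr // ltr_pdivrMr ?ltr0n // mul1r ltr_nat.
  exists zs; split=> //.
  + by rewrite size_map size_iota.
  + apply: path_map_iota => i _; last by rewrite mulr_gt0 // divr_gt0 ?ltr0n.
    by move=> ik; rewrite ltr_pM2l // ltr_pM2r ?invr_gt0 ?ltr0n // ltr_nat.
  + by move=> z /zlt; rewrite lt_min => /andP[].
  + by rewrite A0.
  + move=> t /lB lt.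
    have zst z : z \in zs -> z < t.
      by move/zlt; rewrite lt_min => /andP[h _]; exact: lt_le_trans lt.
    split; first by apply/negP => /zst; rewrite ltxx.
    rewrite (_ : count _ zs = 0%N) //.
    by apply/eqP; rewrite -leqn0 leqNgt -has_count; apply/hasPn => z /zst; rewrite -leNgt => /ltW.
Qed.

(** * The extremal problem *)

Lemma continuous_rowlin (R : realType) n (w : 'I_n -> R) :
  continuous (fun v : 'rV[R]_n => \sum_(j < n) w j * v ord0 j).
Proof.
move=> v.
have -> : (fun v : 'rV[R]_n => \sum_(j < n) w j * v ord0 j) =
    \sum_(j < n) (fun v : 'rV[R]_n => w j * v ord0 j).
  by apply/funext => u; rewrite fct_sumE.
apply: (big_ind (fun g : 'rV[R]_n -> R => {for v, continuous g})).
- exact: cst_continuous.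
- by move=> g h cg ch; apply: continuousD.
- by move=> j _; apply: continuousM; [exact: cst_continuous|exact: coord_continuous].
Qed.

Definition admissible (R : realType) (a b : R) n (alpha f c : nat -> R) :=
  forall t, t \in `[a, b] -> 0 <= row_eval n.+1 alpha c (0%N, t) <= row_eval n.+1 alpha f (0%N, t).

(** The coefficients are parametrized by the values at n + 1 points tau i of [a, b],
which are bounded by those of f: this gives compactness. *)
Lemma exists_max_top (R : realType) (a b : R) n (alpha f : nat -> R) :
  0 < a -> a < b -> increasing_upto n.+1 alpha ->
  (forall t, t \in `[a, b] -> 0 <= row_eval n.+1 alpha f (0%N, t)) ->
  exists2 c, admissible a b n alpha f c &
    forall c', admissible a b n alpha f c' -> c' n <= c n.
Proof.
move=> a0 ab inc f0.
pose tau (i : nat) := a + (b - a) * (i%:R / n.+1%:R).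
have tauab i : (i <= n)%N -> tau i \in `[a, b].
  move=> ni; rewrite in_itv /= lerDl mulr_ge0 ?divr_ge0 ?ler0n ?subr_ge0 ?(ltW ab) //=.
  rewrite /tau -lerBrDl ler_piMr ?subr_ge0 ?(ltW ab) // ler_pdivrMr ?ltr0n // mul1r ler_nat.
  exact: leqW.
pose rs : seq (nat * R) := rows (map (@Single R) (map tau (iota 0 n.+1))).
have rss : size rs = n.+1 by rewrite /rs rows_Single !size_map size_iota.
have rsn k : (k < n.+1)%N -> nth (0%N, 0) rs k = (0%N, tau k).
  move=> km; rewrite /rs rows_Single (nth_map 0) ?size_map ?size_iota //.
  by rewrite (nth_map 0%N) ?size_iota // nth_iota.
pose M := rows_mx n.+1 alpha rs.
have Mu : M \in unitmx.
  rewrite unitmxE unitfE gt_eqF //; apply: det_rows_gt0 => //.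
  rewrite node_pos_Single; apply: path_map_iota => i; last first.
    move=> /andP[_ hi]; move: (tauab i hi); rewrite in_itv /= => /andP[h _]; exact: lt_le_trans h.
  by move=> _ _; rewrite /tau ltrD2l ltr_pM2l ?subr_gt0 // ltr_pM2r ?invr_gt0 ?ltr0n // ltr_nat.
pose C (v : 'rV[R]_n.+1) (i : nat) := \sum_(j < n.+1) invmx M (inord i) j * v ord0 j.
have evC v p : row_eval n.+1 alpha (C v) p =
    \sum_(j < n.+1) (\sum_(i < n.+1) invmx M i j * row_entry alpha p i) * v ord0 j.
  rewrite /row_eval /C; under eq_bigr => i _ do rewrite mulr_suml.
  rewrite exchange_big; apply: eq_bigr => j _; rewrite mulr_suml; apply: eq_bigr => i _.
  by rewrite inord_val mulrAC.
have cevC p : continuous (fun v => row_eval n.+1 alpha (C v) p).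
  have -> : (fun v => row_eval n.+1 alpha (C v) p) = (fun v =>
    \sum_(j < n.+1) (\sum_(i < n.+1) invmx M i j * row_entry alpha p i) * v ord0 j).
    by apply/funext => v; exact: evC.
  exact: continuous_rowlin.
pose box := [set v : 'rV[R]_n.+1 | forall i : 'I_n.+1, [set` `[0, row_eval n.+1 alpha f (0%N, tau i)]] (v ord0 i)].
pose K := [set v | admissible a b n alpha f (C v)].
have cK : closed K.
  have -> : K = \bigcap_(t in [set t | t \in `[a, b]])
     ((fun v => row_eval n.+1 alpha (C v) (0%N, t)) @^-1` [set` `[0, row_eval n.+1 alpha f (0%N, t)]]).
    apply/seteqP; split=> v h t /=; last by move=> tab; have := h t tab; rewrite /= in_itv.
    by move=> tab; rewrite in_itv; exact: h.
  apply: closed_bigI => t _; apply: preimage_closed; last exact: itv_closed.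
  by move=> v _; exact: cevC.
have cpt : compact (box `&` K).
  apply: compact_closedI => //.
  apply: (@rV_compact _ _ (fun i : 'I_n.+1 => [set` `[0, row_eval n.+1 alpha f (0%N, tau i)]])) => i.
  exact: segment_compact.
have [||v vin vmax] := compact_EVT_max (f := fun v => C v n) _ cpt.
- exists 0; split=> [i|t tab] /=.
    by rewrite in_itv /= mxE lexx f0 // tauab // -ltnS.
  rewrite evC big1 ?lexx ?f0 // => j _; by rewrite mxE mulr0.
- apply: continuous_subspaceT => w; exact: continuous_rowlin.
move: vin; rewrite inE => -[_ Kv].
exists (C v) => // c Kc.
pose w : 'rV[R]_n.+1 := \row_j row_eval n.+1 alpha c (0%N, tau j).
have Cw i : (i < n.+1)%N -> C w i = c i.
  move=> ni; have : (invmx M *m (M *m (\col_i c i))) (inord i) 0 = c i.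
    by rewrite mulmxA mulVmx // mul1mx mxE inordK.
  move=> <-; rewrite mxE; apply: eq_bigr => j _; congr (_ * _).
  by rewrite row_eval_rows_mx rsn // mxE.
have evw p : row_eval n.+1 alpha (C w) p = row_eval n.+1 alpha c p.
  by apply: eq_bigr => i _; rewrite Cw.
rewrite -(Cw n) //; apply: vmax; rewrite inE; split=> [i|t tab] /=.
  by rewrite in_itv /= mxE; apply: Kc; apply: tauab; rewrite -ltnS.
by rewrite evw; exact: Kc.
Qed.

Lemma closed_within_preimage (R : realType) (a b : R) (g : R -> R) (D : set R) :
  {within `[a, b], continuous g} -> closed D -> closed (`[a, b] `&` g @^-1` D).
Proof.
move=> /continuous_closedP cg cD.
by rewrite closed_setSI; [exact: cg|exact: itv_closed].
Qed.

(** On the compact set where p <= 0 the function g is bounded below by a positive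
constant; elsewhere p can only help. *)
Lemma nonneg_perturbation (R : realType) (a b : R) (g p : R -> R) :
  a <= b -> {within `[a, b], continuous g} -> {within `[a, b], continuous p} ->
  (forall t, t \in `[a, b] -> 0 <= g t) ->
  (forall t, t \in `[a, b] -> g t = 0 -> 0 < p t) ->
  exists2 e, 0 < e & forall d, 0 < d -> d <= e ->
    forall t, t \in `[a, b] -> 0 <= g t + d * p t.
Proof.
move=> ab cg cp g0 gp.
pose S := `[a, b] `&` p @^-1` [set y | y <= 0].
have S1 t : S t -> t \in `[a, b] by case.
have [[t0 St0]|nS] := pselect (S !=set0); last first.
  exists 1 => // d d0 _ t tab; rewrite addr_ge0 ?g0 // mulr_ge0 ?(ltW d0) //.
  by rewrite leNgt; apply/negP => pt; apply: nS; exists t; split=> //; exact: ltW.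
have cS : compact S.
  apply: (subclosed_compact _ (@segment_compact _ a b)); last by move=> t [].
  exact: closed_within_preimage cp (@closed_le _ 0).
have [||u uS umin] := compact_EVT_min (f := g) _ cS.
- by exists t0.
- by apply: continuous_subspaceW cg => t [].
have [w wab wmin] := EVT_min ab cp.
move: uS; rewrite inE => uS.
have gu : 0 < g u.
  rewrite lt_neqAle g0 ?S1 // andbT eq_sym; apply/eqP => gu.
  have := gp _ (S1 _ uS) gu; case: uS => _ /=; lra.
have w0 : 0 < `|p w| + 1 by rewrite ltr_wpDl.
(* u minimizes g where p <= 0, w minimizes p; the 1 avoids a zero denominator *)
exists (g u / (`|p w| + 1)); first by rewrite divr_gt0.
move=> d d0 de t tab; have [pt|pt] := leP (p t) 0; last first.
  by rewrite addr_ge0 ?g0 // mulr_ge0 ?ltW.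
have gt : g u <= g t by apply: umin; rewrite inE; split.
have pwt := wmin t tab.
have hd : d * (`|p w| + 1) <= g u by rewrite -ler_pdivlMr.
have : - `|p w| <= p w by rewrite lerNl -normrN ler_norm.
move=> h; have : d * p t >= d * (- `|p w|) by rewrite ler_pM2l //; exact: le_trans pwt.
rewrite mulrN; rewrite mulrDr mulr1 in hd; lra.
Qed.

(** If the contact sets with f and with 0 did not alternate n + 1 times, the function
with the separating points as zeros would be an improving direction. *)
Lemma exists_alternation (R : realType) (a b : R) n (alpha f c : nat -> R) :
  0 < a -> a < b -> increasing_upto n.+1 alpha ->
  (forall t, t \in `[a, b] -> 0 < row_eval n.+1 alpha f (0%N, t)) ->
  admissible a b n alpha f c ->
  (forall c', admissible a b n alpha f c' -> c' n <= c n) ->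
  exists u : nat -> R, (forall i, (i < n)%N -> u i.+1 < u i) /\
    forall i, (i <= n)%N -> u i \in `[a, b] /\
      row_eval n.+1 alpha c (0%N, u i) = if odd i then 0 else row_eval n.+1 alpha f (0%N, u i).
Proof.
move=> a0 ab inc f0 Kc cmax.
have b0 := lt_trans a0 ab.
pose g t := row_eval n.+1 alpha c (0%N, t).
pose F t := row_eval n.+1 alpha f (0%N, t).
have cg : {within `[a, b], continuous g} by exact: continuous_row_eval.
have evB c1 c2 d p : row_eval n.+1 alpha (fun i => c1 i + d * c2 i) p =
    row_eval n.+1 alpha c1 p + d * row_eval n.+1 alpha c2 p.
  by rewrite /row_eval mulr_sumr -big_split; apply: eq_bigr => i _ /=; ring.
(* A and B below are defined by h <= 0 and g <= 0; h and g being nonnegative,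
   these are the contact sets with f and with 0 *)
pose h t := F t - g t.
have hE t : row_eval n.+1 alpha (fun i => f i + (- 1) * c i) (0%N, t) = h t.
  by rewrite evB mulN1r.
have ch : {within `[a, b], continuous h}.
  have -> : h = fun t => row_eval n.+1 alpha (fun i => f i + (- 1) * c i) (0%N, t).
    by apply/funext => t; rewrite hE.
  exact: continuous_row_eval.
pose A := `[a, b] `&` h @^-1` [set y | y <= 0].
pose B := `[a, b] `&` g @^-1` [set y | y <= 0].
have AE t : A t -> t \in `[a, b] /\ g t = F t.
  move=> [tab /=]; rewrite /h => ht; split=> //.
  by have /andP[_] := Kc t tab; rewrite -/(g t) -/(F t) => ?; lra.
have BE t : B t -> t \in `[a, b] /\ g t = 0.
  move=> [tab /=] gt; split=> //.
  by have /andP[+ _] := Kc t tab; rewrite -/(g t) => ?; lra.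
have cA : closed A by exact: closed_within_preimage ch (@closed_le _ 0).
have cB : closed B by exact: closed_within_preimage cg (@closed_le _ 0).
have abE t : t \in `[a, b] -> a <= t /\ t <= b by rewrite in_itv /= => /andP.
case: (@alternation_or_separation R n A B a (b + 1)) => //.
- by rewrite addr_gt0.
- apply/seteqP; split=> // t [/AE[tab gF] /BE[_ g0]].
  by have := f0 t tab; rewrite -/(F t) -gF g0 ltxx.
- by move=> t /AE[/abE[]].
- by move=> t /BE[/abE[]].
- by move=> t /AE[/abE[_ tb] _]; rewrite ltr_pwDr.
- move=> [u [u1 u2]]; exists u; split=> // i ni.
  by have := u2 i ni; case: (odd i) => [/BE|/AE].
move=> [zs [zk zp _ zA zB]].
pose p t := row_eval n.+1 alpha (zero_coef n alpha zs) (0%N, t).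
have cp : {within `[a, b], continuous p} by exact: continuous_row_eval.
have sgn t : t \in `[a, b] -> t \notin zs -> 0 < (-1) ^+ odd (count (> t) zs) * p t.
  by move=> /abE[ta _] tz; rewrite signr_odd zero_coef_sign //; exact: lt_le_trans ta.
have [|t tab gt0|e1 e10 he1] := nonneg_perturbation (ltW ab) cg cp.
- by move=> t /Kc/andP[].
- have Bt : B t by split=> //=; rewrite gt0.
  by have [h1 h2] := zB _ Bt; have := sgn t tab h1; rewrite (negbTE h2) mul1r.
have cNp : {within `[a, b], continuous (fun t => - p t)}.
  have -> : (fun t => - p t) = fun t => row_eval n.+1 alpha (fun i => 0 + (- 1) * zero_coef n alpha zs i) (0%N, t).
    by apply/funext => t; rewrite (evB (fun _ => 0)) mulN1r /row_eval big1 ?add0r // => i _; rewrite mul0r.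
  exact: continuous_row_eval.
have [|t tab ht0|e2 e20 he2] := nonneg_perturbation (ltW ab) ch cNp.
- by move=> t /Kc/andP[_]; rewrite subr_ge0.
- have At : A t by split=> //=; rewrite ht0.
  by have [h1 h2] := zA _ At; have := sgn t tab h1; rewrite h2 expr1 mulN1r.
pose d := Num.min e1 e2.
have d0 : 0 < d by rewrite lt_min e10.
have : admissible a b n alpha f (fun i => c i + d * zero_coef n alpha zs i).
  move=> t tab; rewrite evB -/(g t) -/(F t) -/(p t).
  rewrite he1 ?ge_min ?lexx //=.
  have := he2 d d0 _ t tab; rewrite ge_min lexx orbT mulrN /h => /(_ isT); lra.
move/cmax; rewrite gerDl leNgt mulr_gt0 //.
exact: zero_coef_top.
Qed.

(** * Determinants over nodes *)

Definition exponents (R : realType) n (alpha : 'I_n.+1 -> R) (i : nat) : R := alpha (inord i).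

Lemma lin_monomialP (R : realType) n (alpha : 'I_n.+1 -> R) (g : R -> R) :
  lin (range (monomial alpha)) g <->
  exists c, g = fun t => row_eval n.+1 (exponents alpha) c (0%N, t).
Proof.
have evE (c : nat -> R) t : row_eval n.+1 (exponents alpha) c (0%N, t) = \sum_(i < n.+1) c i * monomial alpha i t.
  by apply: eq_bigr => i _; rewrite /row_entry /= /exponents inord_val.
split=> [[k [h [c [hr ->]]]]|[c ->]].
  have /choice[j hj] : forall i : 'I_k, exists j, monomial alpha j = h i.
    by move=> i; have [j _ <-] := hr i; exists j.
  exists (fun l => \sum_(i < k | j i == inord l) c i); apply/funext => t.
  rewrite evE (partition_big j predT) //=; apply: eq_bigr => l _.
  rewrite mulr_suml inord_val; apply: eq_bigr => i /eqP jl.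
  by rewrite -hj jl.
exists n.+1, (monomial alpha), (fun i => c i); split; first by move=> i; exists i.
by apply/funext => t; exact: evE.
Qed.

Lemma node_mxE (R : realType) n (alpha : 'I_n.+1 -> R) (s : seq (node R)) :
  (forall p, p \in rows s -> 0 < p.2) -> size (rows s) = n.+1 ->
  node_mx (monomial alpha) s = rows_mx n.+1 (exponents alpha) (rows s).
Proof.
move=> sp ss; apply/matrixP => k i; rewrite !mxE -/(rows s).
have pin : nth (0%N, 0) (rows s) k \in rows s by rewrite mem_nth ?ss.
have z0 := sp _ pin.
move: pin z0; case: (nth _ _ _) => d z pin /= z0.
have d2 : (d < 2)%N.
  elim: (s) pin => // x s' IH; rewrite rows_cons mem_cat => /orP[|/IH//].
  by case: (x) => y /=; rewrite !inE; [|case/orP]; case/eqP => ->.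
move: d2 => {pin}; rewrite /row_entry /exponents inord_val; case: d => [|[|//]] //= _.
rewrite /derive1n /= derive1E.
have d1 := is_derive1_powR (alpha i) z0.
exact: (@derive_val _ _ _ _ _ _ _ d1).
Qed.

Lemma det_node_eq0 (R : realType) n (alpha : 'I_n.+1 -> R) (s : seq (node R)) z :
  size (rows s) = n -> (0%N, z) \in rows s ->
  \det (node_mx (monomial alpha) (Single z :: s)) = 0.
Proof.
move=> ss zin; have hi : ((index (0%N, z) (rows s)).+1 < n.+1)%N by rewrite ltnS -ss index_mem.
apply: (@determinant_alternate _ _ _ ord0 (Ordinal hi)) => // i.
by rewrite !mxE /= -/(rows s) nth_index.
Qed.

(** The sign of the constant is isolated as that of the top coefficient: for the two
summands it is read off from opposite inequalities on that coefficient. *)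
Lemma node_repr (R : realType) n (alpha : 'I_n.+1 -> R) c (s : seq (node R)) z :
  increasing_upto n.+1 (exponents alpha) -> path <%R 0 (map (@node_pos R) s) -> size (rows s) = n ->
  (forall p, p \in rows s -> row_eval n.+1 (exponents alpha) c p = 0) ->
  0 < z -> row_eval n.+1 (exponents alpha) c (0%N, z) != 0 ->
  c n != 0 /\ exists2 k, 0 < k & forall t, 0 < t ->
    row_eval n.+1 (exponents alpha) c (0%N, t) =
      (-1) ^+ n * Num.sg (c n) * k * \det (node_mx (monomial alpha) (Single t :: s)).
Proof.
move=> inc ps ss hz z0 zn0; have rep := row_eval_det_repr inc ps ss hz.
have D0 := det_rows_gt0 (increasing_uptoW inc) ps ss.
have cn0 : c n != 0.
  by apply: contraNneq zn0 => cn; rewrite rep cn mul0r mulr0 mul0r.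
split=> //; exists (`|c n| / \det (rows_mx n (exponents alpha) (rows s))).
  by rewrite divr_gt0 // normr_gt0.
move=> t t0; rewrite rep node_mxE.
- by rewrite {1}[c n]numEsg /=; congr (_ * _); rewrite !mulrA.
- move=> p; rewrite rows_cons mem_cat inE => /orP[/eqP->//|/rows_pos].
  exact: path_lt.
- by rewrite rows_cons /= ss.
Qed.

Lemma nonneg_zero_double (R : realType) (a b : R) n (alpha c : nat -> R) z :
  0 < a -> (forall t, t \in `[a, b] -> 0 <= row_eval n alpha c (0%N, t)) ->
  a < z < b -> row_eval n alpha c (0%N, z) = 0 -> row_eval n alpha c (1%N, z) = 0.
Proof.
move=> a0 h0 /andP[az zb] hz.
have dz := is_derive_row_eval n alpha c (lt_trans a0 az).
have dz0 : is_derive z 1 (fun t => row_eval n alpha c (0%N, t)) 0.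
  apply: (@derive1_at_min _ _ a b).
  - exact: ltW (lt_trans az zb).
  - move=> t; rewrite in_itv /= => /andP[ta _].
    by have [] := is_derive_row_eval n alpha c (lt_trans a0 ta).
  - by rewrite in_itv /= az zb.
  - move=> t; rewrite in_itv /= hz => /andP[ta tb]; apply: h0.
    by rewrite in_itv /= !ltW.
by rewrite -(@derive_val _ _ _ _ _ _ _ dz) (@derive_val _ _ _ _ _ _ _ dz0).
Qed.

(** Zeros in the open interval are double, so m + 1 zeros amount to 2 (m + 1) with
multiplicity, up to one at each end of the interval; the zero count bounds this
by n. *)
Lemma nonneg_zeros_le (R : realType) (a b : R) n (alpha c : nat -> R) (v : nat -> R) m x :
  0 < a -> increasing_upto n.+1 alpha ->
  (forall t, t \in `[a, b] -> 0 <= row_eval n.+1 alpha c (0%N, t)) ->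
  (forall i j, (i < j)%N -> (j <= m)%N -> v i < v j) ->
  (forall k, (k <= m)%N -> v k \in `[a, b] /\ row_eval n.+1 alpha c (0%N, v k) = 0) ->
  row_eval n.+1 alpha c (0%N, x) != 0 ->
  (2 * m.+1 <= n + (v 0%N == a) + (v m == b))%N.
Proof.
move=> a0 inc h0 vinc vz; apply: contraNT; rewrite -ltnNge => lt.
(* only the first zero can be a and only the last one can be b *)
pose s1 k := (k == 0%N) && (v 0%N == a); pose s2 k := (k == m) && (v m == b).
pose nd k : node R := if s1 k || s2 k then Single (v k) else Double (v k).
pose s := map nd (iota 0 m.+1).
have pnd k : node_pos (nd k) = v k by rewrite /nd; case: ifP.
have vpos k : (k <= m)%N -> 0 < v k.
  by move=> /vz[]; rewrite in_itv /= => /andP[h _] _; exact: lt_le_trans h.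
have ss : (n.+1 <= size (rows s))%N.
  have -> : size (rows s) = (\sum_(k < m.+1) size (node_rows (nd k)))%N.
    by rewrite /rows /s -map_comp size_flatten sumnE /shape !big_map -(big_mkord xpredT (fun k => size (node_rows (nd k)))) /index_iota subn0.
  have le2 : (2 * m.+1 <= \sum_(k < m.+1) (size (node_rows (nd k)) + s1 k + s2 k))%N.
    rewrite -[in X in (X <= _)%N](card_ord m.+1) mulnC -sum_nat_const; apply: leq_sum => k _.
    by rewrite /nd; case: (s1 k); case: (s2 k).
  have e1 : (\sum_(k < m.+1) s1 k = (v 0%N == a))%N.
    by rewrite big_ord_recl big1 ?addn0.
  have e2 : (\sum_(k < m.+1) s2 k = (v m == b))%N.
    rewrite big_ord_recr big1 ?add0n /s2 ?eqxx //= => i _.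
    by rewrite ltn_eqF.
  move: le2; rewrite !big_split /= e1 e2; lia.
apply/eqP; rewrite /row_eval big1 // => i _; rewrite (zero_count inc (s := s)) ?mul0r //.
  rewrite /s -map_comp (eq_map pnd); apply: path_map_iota => k; rewrite add0n.
    by move=> _ km; apply: vinc.
  by move=> km; apply: vpos.
move=> p; rewrite /rows /s -map_comp => /flatten_mapP[k].
rewrite mem_iota add0n /= ltnS => km pin.
have [vab vk0] := vz k km.
move: pin; rewrite /= /nd /s1 /s2; case: ifP => /= [_|/negbT]; rewrite !inE.
  by move=> /eqP->.
rewrite negb_or !negb_and => /andP[na nb] /orP[/eqP->//|/eqP->].
apply: (nonneg_zero_double a0 h0) => //.
have vle j : (j <= m)%N -> a <= v j <= b by move/vz=> [+ _]; rewrite in_itv.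
have /andP[av vb] := vle k km.
rewrite !lt_neqAle av vb !andbT; apply/andP; split; apply/eqP => E.
  case: (posnP k) na => [k0|k0 _]; first by rewrite E k0 !eqxx.
  have := vinc 0%N k k0 km; rewrite -E.
  by case/andP: (vle 0%N (leq0n _)) => h _; rewrite ltNge h.
move: (km); rewrite leq_eqVlt => /orP[/eqP {}km|{}km]; first by move: nb; rewrite -E km !eqxx.
have := vinc k m km (leqnn _); rewrite E.
by case/andP: (vle m (leqnn _)) => _ h; rewrite ltNge h.
Qed.

(** The difference of an admissible function and an alternating one has
weakly alternating signs at the alternation points. *)
Lemma alternating_unique (R : realType) (a b : R) n (alpha f c1 c2 t : nat -> R) :
  0 < a -> increasing_upto n.+1 alpha -> admissible a b n alpha f c2 ->
  (forall i, (i < n)%N -> t i < t i.+1) ->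
  (forall k, (k <= n)%N -> t k \in `[a, b] /\
     row_eval n.+1 alpha c1 (0%N, t k) = if odd (n - k) then 0 else row_eval n.+1 alpha f (0%N, t k)) ->
  c1 n <= c2 n -> forall i, (i < n.+1)%N -> c1 i = c2 i.
Proof.
move=> a0 inc K2 tS ht le i ni; apply/esym/eqP; rewrite -subr_eq0; apply/eqP.
apply: (@alternation_cramer R n alpha (fun i => c2 i - c1 i) t) => //.
- by have [+ _] := ht 0%N (leq0n _); rewrite in_itv /= => /andP[h _]; exact: lt_le_trans h.
- move=> k kn; have [tab tk] := ht k kn.
  have -> : row_eval n.+1 alpha (fun i => c2 i - c1 i) (0%N, t k) =
     row_eval n.+1 alpha c2 (0%N, t k) - row_eval n.+1 alpha c1 (0%N, t k).
    by rewrite /row_eval -sumrB; apply: eq_bigr => j _; rewrite mulrBl.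
  rewrite tk -signr_odd oddD; move: (K2 _ tab) => /andP[ge lef].
  rewrite oddB //; case: (odd n); case: (odd k); rewrite /= ?expr0 ?expr1; lra.
- by rewrite subr_ge0.
Qed.

(** * The form of the maximizer *)

Lemma nth_pairs (R : realType) (p q : nat -> R) s m j : (j < m)%N ->
  nth 0 (flatten [seq [:: p i; q i] | i <- iota s m]) j.*2 = p (s + j)%N /\
  nth 0 (flatten [seq [:: p i; q i] | i <- iota s m]) j.*2.+1 = q (s + j)%N.
Proof.
elim: m s j => // m IH s [|j] jm /=; first by rewrite addn0.
by rewrite addnS -addSn; exact: IH.
Qed.

Lemma size_pairs (R : realType) (p q : nat -> R) s m :
  size (flatten [seq [:: p i; q i] | i <- iota s m]) = m.*2.
Proof. by elim: m s => //= m IH s; rewrite IH. Qed.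

(** This turns the interlacing of x and y into the growth of a single sequence
indexed from a. *)
Lemma nth_even_snake (R : realType) (a b : R) (x y : nat -> R) m k : (k <= m.+1.*2)%N ->
  nth 0 ([:: a; x 1%N] ++ flatten [seq [:: y i; x i.+1] | i <- iota 1 m] ++ [:: b]) k =
  if k == 0%N then a else if k == m.+1.*2 then b else if odd k then x k.+1./2 else y k./2.
Proof.
case: k => [|[|k]] //= km; rewrite nth_cat size_pairs !eqSS negbK.
rewrite doubleS !ltnS in km *; case: ltnP => km'; last first.
  have -> : k = m.*2 by apply/eqP; rewrite eqn_leq km km'.
  by rewrite subnn eqxx.
rewrite ltn_eqF //.
have jm : (k./2 < m)%N by lia.
have [h1 h2] := nth_pairs y (fun i => x i.+1) 1 jm.
by rewrite -(odd_double_half k); case: (odd k); rewrite /= ?add1n ?add0n ?h1 ?h2 /= ?odd_double ?doubleK ?uphalf_double.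
Qed.

Lemma nth_odd_snake (R : realType) (a b : R) (x y : nat -> R) m k : (k <= m.*2.+1)%N ->
  nth 0 ([:: a] ++ flatten [seq [:: y i; x i] | i <- iota 1 m] ++ [:: b]) k =
  if k == 0%N then a else if k == m.*2.+1 then b else if odd k then y k.+1./2 else x k./2.
Proof.
case: k => [|k] //= km; rewrite nth_cat size_pairs !eqSS.
rewrite ltnS in km; case: ltnP => km'; last first.
  have -> : k = m.*2 by apply/eqP; rewrite eqn_leq km km'.
  by rewrite subnn eqxx.
rewrite ltn_eqF //.
have jm : (k./2 < m)%N by lia.
have [h1 h2] := nth_pairs y x 1 jm.
by rewrite -(odd_double_half k); case: (odd k); rewrite /= ?add1n ?add0n ?h1 ?h2 /= ?odd_double ?doubleK ?uphalf_double.
Qed.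

Lemma size_Double (R : realType) (v : nat -> R) s :
  size (rows (map (fun i => Double (v i)) s)) = (size s).*2.
Proof. by elim: s => // i s IH; rewrite map_cons rows_cons size_cat IH. Qed.

Lemma rows_cat (R : realType) (s1 s2 : seq (node R)) : rows (s1 ++ s2) = rows s1 ++ rows s2.
Proof. by rewrite /rows map_cat flatten_cat. Qed.

Lemma node_pos_Double (R : realType) (v : nat -> R) s :
  map (@node_pos R) (map (fun i => Double (v i)) s) = map v s.
Proof. by rewrite -map_comp. Qed.

Lemma row_eval_rows_Double (R : realType) n (alpha c : nat -> R) (v : nat -> R) s :
  (forall i, i \in s -> row_eval n alpha c (0%N, v i) = 0 /\ row_eval n alpha c (1%N, v i) = 0) ->
  forall p, p \in rows (map (fun i => Double (v i)) s) -> row_eval n alpha c p = 0.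
Proof.
move=> h p; rewrite /rows -map_comp => /flatten_mapP[i /h[h0 h1]] /=.
by rewrite !inE => /orP[/eqP->|/eqP->].
Qed.

(** The points u decrease from b to a, the even ones being zeros of f - g and the odd
ones zeros of g.  Counted from the left, this puts the zeros of g at the odd
places if n is even, and those of f - g if n is odd. *)
Lemma snake_form (R : realType) (a b : R) n (alpha : 'I_n.+1 -> R) (f c u : nat -> R) :
  0 < a -> (0 < n)%N -> increasing_upto n.+1 (exponents alpha) ->
  (forall t, t \in `[a, b] -> 0 < row_eval n.+1 (exponents alpha) f (0%N, t)) ->
  admissible a b n (exponents alpha) f c -> 0 <= c n -> f n <= c n ->
  (forall i, (i < n)%N -> u i.+1 < u i) ->
  (forall i, (i <= n)%N -> u i \in `[a, b] /\
      row_eval n.+1 (exponents alpha) c (0%N, u i) =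
      if odd i then 0 else row_eval n.+1 (exponents alpha) f (0%N, u i)) ->
  let fl t := row_eval n.+1 (exponents alpha) c (0%N, t) in
  let fu t := row_eval n.+1 (exponents alpha) (fun i => f i - c i) (0%N, t) in
  (exists2 m, n = (2 * m)%N & even_form a b (monomial alpha) m fl fu) \/
  (exists2 m, n = (2 * m + 1)%N & odd_form a b (monomial alpha) m fl fu).
Proof.
move=> a0 n0 inc f0 Kc cn0 fcn uS hu fl fu.
pose d i := f i - c i.
have evd p : row_eval n.+1 (exponents alpha) d p =
    row_eval n.+1 (exponents alpha) f p - row_eval n.+1 (exponents alpha) c p.
  by rewrite /row_eval -sumrB; apply: eq_bigr => i _; rewrite mulrBl.
have udec i j : (i < j)%N -> (j <= n)%N -> u j < u i.
  elim: j => // j IH; rewrite ltnS leq_eqVlt => /orP[/eqP->|ij] jn; first exact: uS.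
  by apply: lt_trans (uS _ jn) _; apply: IH => //; exact: ltnW.
have uab i : (i <= n)%N -> a <= u i <= b by move/hu => [+ _]; rewrite in_itv.
have upos i : (i <= n)%N -> 0 < u i by move/uab/andP=> [h _]; exact: lt_le_trans h.
have c0 t : t \in `[a, b] -> 0 <= row_eval n.+1 (exponents alpha) c (0%N, t).
  by move/Kc/andP => [].
have d0 t : t \in `[a, b] -> 0 <= row_eval n.+1 (exponents alpha) d (0%N, t).
  by move/Kc/andP => []; rewrite evd subr_ge0.
have cz i : (i <= n)%N -> odd i -> row_eval n.+1 (exponents alpha) c (0%N, u i) = 0.
  by move/hu => [_ ->] ->.
have dz i : (i <= n)%N -> ~~ odd i -> row_eval n.+1 (exponents alpha) d (0%N, u i) = 0.
  by rewrite evd => /hu [_ ->] /negbTE ->; rewrite subrr.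
have cnz : row_eval n.+1 (exponents alpha) c (0%N, u 0%N) != 0.
  by have [uab0 ->] := hu 0%N (leq0n _); rewrite gt_eqF // f0.
have dnz : row_eval n.+1 (exponents alpha) d (0%N, u 1%N) != 0.
  by have [uab0 h] := hu 1%N n0; rewrite evd h subr0 gt_eqF // f0.
have nE := odd_double_half n.
(* otherwise a summand would have more than n zeros *)
have [u0b una] : u 0%N = b /\ u n = a.
  have := @nonneg_zeros_le R a b n _ d (fun k => u (n./2 - k).*2) n./2 _ a0 inc d0 _ _ dnz.
  rewrite subn0 subnn double0 => Hd.
  have {}Hd : (2 * n./2.+1 <= n + (u n./2.*2 == a) + (u 0%N == b))%N.
    apply: Hd => [i j ij jn|k kn]; first by apply: udec; lia.
    have hk : ((n./2 - k).*2 <= n)%N by lia.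
    by split; [have [] := hu _ hk|apply: dz; rewrite ?odd_double].
  have [on|en] := boolP (odd n); last first.
    have e2 : n./2.*2 = n by rewrite -[RHS]nE (negbTE en).
    rewrite e2 in Hd; move: Hd.
    by case: (u n =P a) => [->|_]; case: (u 0%N =P b) => [->|_] //= h; exfalso; lia.
  have una : (u n./2.*2 == a) = false.
    rewrite gt_eqF //; have /andP[h _] := uab n (leqnn _).
    by apply: le_lt_trans h _; apply: udec => //; clear -nE on; lia.
  rewrite una addn0 in Hd.
  have u0b : u 0%N = b by move: Hd; case: eqP => // _ h; exfalso; lia.
  split=> //.
  have := @nonneg_zeros_le R a b n _ c (fun k => u (n./2 - k).*2.+1) n./2 _ a0 inc c0 _ _ cnz.
  rewrite subn0 subnn double0 => Hc.
  have {}Hc : (2 * n./2.+1 <= n + (u n./2.*2.+1 == a) + (u 1%N == b))%N.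
    apply: Hc => [i j ij jn|k kn]; first by apply: udec; clear -nE on ij jn; lia.
    have hk : ((n./2 - k).*2.+1 <= n)%N by clear -nE on kn; lia.
    by split; [have [] := hu _ hk|apply: cz; rewrite //= odd_double].
  rewrite -u0b (lt_eqF (udec 0%N 1%N isT n0)) addn0 in Hc.
  have e2 : n./2.*2.+1 = n by rewrite -[RHS]nE on.
  by rewrite e2 in Hc; move: Hc; case: eqP => // _ h; exfalso; clear -h e2; lia.
have uin i : (0 < i < n)%N -> a < u i < b.
  by move=> /andP[i0 i1]; rewrite -u0b -una !udec // ltnW.
have cz2 i : (0 < i < n)%N -> odd i -> row_eval n.+1 (exponents alpha) c (0%N, u i) = 0 /\
    row_eval n.+1 (exponents alpha) c (1%N, u i) = 0.
  move=> hi oi; have h := cz i (ltnW (proj2 (andP hi))) oi.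
  by split=> //; exact: (nonneg_zero_double a0 c0 (uin _ hi)).
have dz2 i : (0 < i < n)%N -> ~~ odd i -> row_eval n.+1 (exponents alpha) d (0%N, u i) = 0 /\
    row_eval n.+1 (exponents alpha) d (1%N, u i) = 0.
  move=> hi oi; have h := dz i (ltnW (proj2 (andP hi))) oi.
  by split=> //; exact: (nonneg_zero_double a0 d0 (uin _ hi)).
have tpos t : t \in `[a, b] -> 0 < t.
  by rewrite in_itv => /andP[h _]; exact: lt_le_trans h.
have dn0 : d n <= 0 by rewrite subr_le0.
have az : ~~ odd n -> row_eval n.+1 (exponents alpha) d (0%N, a) = 0 by rewrite -una; exact: dz.
have az' : odd n -> row_eval n.+1 (exponents alpha) c (0%N, a) = 0 by rewrite -una; exact: cz.
have bz : row_eval n.+1 (exponents alpha) d (0%N, b) = 0 by rewrite -u0b; exact: dz.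
(* counted from a, the points w are those of odd index and v those of even index *)
pose w i := u (n - i.*2.-1)%N.
pose v i := u (n - i.*2)%N.
have v0 : v 0%N = a by rewrite /v subn0.
have [on|en] := boolP (odd n).
  right; exists n./2; first by rewrite -[LHS]nE on mul2n addnC.
  have nE' : n = n./2.*2.+1 by rewrite -[LHS]nE on.
  have [|||||cn [k1 k10 k1E]] := @node_repr R n alpha c
    (Single a :: [seq Double (v i) | i <- iota 1 n./2]) (u 0%N) inc.
  - have -> : [seq node_pos i | i <- Single a :: [seq Double (v i) | i <- iota 1 n./2]] =
        map v (iota 0 n./2.+1) by rewrite /= node_pos_Double v0.
    apply: path_map_iota => i; [move=> _ hi; apply: udec|move=> hi; apply: upos]; clear -hi nE'; lia.
  - by rewrite rows_cons size_cat size_Double size_iota /=; clear -nE'; lia.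
  - move=> p; rewrite rows_cons mem_cat inE => /orP[/eqP->|]; first exact: az'.
    apply: row_eval_rows_Double => i; rewrite mem_iota => hi; have hi' : (i.*2 <= n)%N by clear -hi nE'; lia.
    by apply: cz2; [clear -hi nE'; lia|rewrite oddB ?on ?odd_double].
  - exact: upos.
  - exact: cnz.
  have [|||||dn [k2 k20 k2E]] := @node_repr R n alpha d
    ([seq Double (w i) | i <- iota 1 n./2] ++ [:: Single b]) (u 1%N) inc.
  - have -> : [seq node_pos i | i <- [seq Double (w i) | i <- iota 1 n./2] ++ [:: Single b]] =
        map w (iota 1 n./2.+1).
      by rewrite map_cat node_pos_Double -(addn1 n./2) iotaD map_cat /= /w add1n doubleS /= -nE' subnn u0b.
    apply: path_map_iota => i; [move=> i1 hi; apply: udec; clear -i1 hi nE'|move=> hi; apply: upos; clear -hi nE']; lia.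
  - by rewrite rows_cat size_cat size_Double size_iota /=; clear -nE'; lia.
  - move=> p; rewrite rows_cat mem_cat => /orP[|]; last by rewrite inE => /eqP->.
    apply: row_eval_rows_Double => i; rewrite mem_iota => hi; have hi' : (i.*2 <= n)%N by clear -hi nE'; lia.
    by apply: dz2; clear -hi on nE'; lia.
  - exact: upos.
  - exact: dnz.
  have sc : Num.sg (c n) = 1 by apply: gtr0_sg; rewrite lt_neqAle eq_sym cn.
  have sd : Num.sg (d n) = -1 by apply: ltr0_sg; rewrite lt_neqAle dn.
  exists v, w, k1, k2; split=> //.
  - apply/(sortedP 0) => i.
    have snk k : (k <= n)%N -> nth 0 ([:: a] ++ flatten [seq [:: w i; v i] | i <- iota 1 n./2] ++ [:: b]) k = u (n - k)%N.
      move=> kn; rewrite nth_odd_snake -?nE' //.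
      case: eqP => [->|k0]; first by rewrite subn0.
      case: eqP => [->|kn']; first by rewrite subnn.
      case: ifP => ok; first by rewrite /w -uphalfE odd_uphalfK.
      by rewrite /v even_halfK ?ok.
    rewrite !size_cat size_pairs => hi; rewrite /= in hi.
  have {}hi : (i < n)%N by clear -hi nE'; lia.
    by rewrite !snk ?(ltnW hi) //; apply: udec; rewrite ?ltn_sub2l ?leq_subr.
  - move=> t tab; split; last exact: c0.
    by rewrite /fl k1E ?tpos // sc -signr_odd on mulr1 expr1 mulN1r.
  - move=> t tab; split; last exact: d0.
    by rewrite /fu k2E ?tpos // sd -signr_odd on expr1 mulrNN !mul1r.
left; exists n./2; first by rewrite -[LHS]nE (negbTE en) mul2n.
have nE' : n = n./2.*2 by rewrite -[LHS]nE (negbTE en).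
case E : n./2 => [|m]; first by rewrite nE' E in n0.
have {}nE' : n = m.+1.*2 by rewrite -E.
have [|||||cn [k1 k10 k1E]] := @node_repr R n alpha c
  ([seq Double (w i) | i <- iota 1 m.+1]) (u 0%N) inc.
- rewrite node_pos_Double.
  apply: path_map_iota => i; [move=> i1 hi; apply: udec; clear -i1 hi nE'|move=> hi; apply: upos; clear -hi nE']; lia.
- by rewrite size_Double size_iota; clear -nE'; lia.
- apply: row_eval_rows_Double => i; rewrite mem_iota => hi; have hi' : (i.*2 <= n)%N by clear -hi nE'; lia.
  by apply: cz2; clear -hi nE'; lia.
- exact: upos.
- exact: cnz.
have [|||||dn [k2 k20 k2E]] := @node_repr R n alpha d
  (Single a :: [seq Double (v i) | i <- iota 1 m] ++ [:: Single b]) (u 1%N) inc.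
- have -> : [seq node_pos i | i <- Single a :: [seq Double (v i) | i <- iota 1 m] ++ [:: Single b]] =
      map v (iota 0 m.+2).
    rewrite map_cons map_cat node_pos_Double -[iota 0 m.+2]/(0%N :: iota 1 m.+1) -(addn1 m) iotaD.
    by rewrite /= map_cat /= v0 /v add1n -nE' subnn u0b.
  apply: path_map_iota => i; [move=> _ hi; apply: udec|move=> hi; apply: upos]; clear -hi nE'; lia.
- by rewrite rows_cons rows_cat !size_cat size_Double size_iota /=; clear -nE'; lia.
- move=> p; rewrite rows_cons rows_cat !mem_cat !inE orbF => /or3P[/eqP->| |/eqP->//]; first exact: az.
  apply: row_eval_rows_Double => i; rewrite mem_iota => hi; have hi' : (i.*2 <= n)%N by clear -hi nE'; lia.
  by apply: dz2; clear -hi nE'; lia.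
- exact: upos.
- exact: dnz.
have sc : Num.sg (c n) = 1 by apply: gtr0_sg; rewrite lt_neqAle eq_sym cn.
have sd : Num.sg (d n) = -1 by apply: ltr0_sg; rewrite lt_neqAle dn.
exists w, v, k1, k2; split=> //.
- apply/(sortedP 0) => i.
  have snk k : (k <= n)%N -> nth 0 ([:: a; w 1%N] ++ flatten [seq [:: v i; w i.+1] | i <- iota 1 m] ++ [:: b]) k = u (n - k)%N.
    move=> kn; rewrite nth_even_snake -?nE' //.
    case: eqP => [->|k0]; first by rewrite subn0.
    case: eqP => [->|kn']; first by rewrite subnn.
    case: ifP => ok; first by rewrite /w -uphalfE odd_uphalfK.
      by rewrite /v even_halfK ?ok.
  rewrite !size_cat size_pairs => hi; rewrite /= in hi.
  have {}hi : (i < n)%N by clear -hi nE'; lia.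
  by rewrite !snk ?(ltnW hi) //; apply: udec; rewrite ?ltn_sub2l ?leq_subr.
- move=> t tab; split; last exact: c0.
  by rewrite /fl k1E ?tpos // sc -signr_odd (negbTE en) !mul1r.
- move=> t tab; split; last exact: d0.
  by rewrite /fu k2E ?tpos // sd -signr_odd (negbTE en) mul1r mulN1r.
Qed.

(** * Alternation determines the decomposition *)

Lemma sorted_nth_itv (R : realType) (a b : R) (L : seq R) n :
  sorted <%R L -> size L = n.+1 -> nth 0 L 0 = a -> nth 0 L n = b ->
  (forall i, (i < n)%N -> nth 0 L i < nth 0 L i.+1) /\
  forall k, (k <= n)%N -> nth 0 L k \in `[a, b].
Proof.
move=> so sL La Lb; split=> [i hi|k kn].
  by move/(sortedP 0): so; apply; rewrite sL.
have le : {in [pred i | (i < size L)%N] &, {homo nth 0 L : i j / (i <= j)%N >-> i <= j}}.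
  by apply: sorted_leq_nth; [exact: le_trans|exact: lexx|exact: sub_sorted ltW _ so].
by rewrite in_itv /= -La -Lb !le // inE sL.
Qed.

Lemma mem_rows_Double (R : realType) (v : nat -> R) s i : i \in s ->
  (0%N, v i) \in rows (map (fun i => Double (v i)) s).
Proof.
move=> si; rewrite /rows -map_comp; apply/flatten_mapP; exists i => //=.
by rewrite inE eqxx.
Qed.

(** A determinant vanishes when the free point is one of its nodes; this gives the
zeros of gl, and the zeros of gu are points where gl = f. *)
Lemma even_form_alternates (R : realType) (a b : R) n (alpha : 'I_n.+1 -> R) m (f gl gu : R -> R) :
  (0 < n)%N -> n = (2 * m)%N -> (forall t, f t = gl t + gu t) ->
  even_form a b (monomial alpha) m gl gu ->
  (forall t, t \in `[a, b] -> 0 <= gl t <= f t) /\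
  exists t : nat -> R, (forall i, (i < n)%N -> t i < t i.+1) /\
    forall k, (k <= n)%N -> t k \in `[a, b] /\ gl (t k) = if odd (n - k) then 0 else f (t k).
Proof.
move=> n0 nE fE [x [y [cl [cu [so _ _ hl hu]]]]].
split=> [t tab|].
  by rewrite fE lerDl (proj2 (hl _ tab)) (proj2 (hu _ tab)).
case: m nE so hl hu => [|m] nE so hl hu; first by rewrite nE in n0.
have {}nE : n = m.+1.*2 by rewrite nE mul2n.
set L := _ ++ _ in so.
have sL : size L = n.+1 by rewrite !size_cat size_pairs nE /= addn1 doubleS.
have Lk k : (k <= n)%N -> nth 0 L k =
    if k == 0%N then a else if k == n then b else if odd k then x k.+1./2 else y k./2.
  by rewrite nE; exact: nth_even_snake.
have Ln : nth 0 L n = b by rewrite Lk // eqxx gtn_eqF.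
have [L1 L2] := sorted_nth_itv so sL (Lk 0%N (leq0n _)) Ln.
exists (nth 0 L); split=> // k kn; split; first exact: L2.
have on : odd n = false by rewrite nE odd_double.
have := L2 k kn; rewrite Lk // oddB // on addFb.
have gu0 z : z \in `[a, b] -> gu z = 0 -> gl z = f z by move=> _ h; rewrite fE h addr0.
have hsz : size (rows ([:: Single a] ++ [seq Double (y i) | i <- iota 1 m] ++ [:: Single b])) = n.
  by rewrite !rows_cat !size_cat size_Double size_iota nE /= addn1.
case: eqP => [->|k0] /=.
  move=> zab; apply: gu0 => //; rewrite (proj1 (hu _ zab)) det_node_eq0 ?mulr0 //.
  by rewrite rows_cons mem_cat inE eqxx.
case: eqP => [->|kn'].
  rewrite on => zab; apply: gu0 => //; rewrite (proj1 (hu _ zab)) det_node_eq0 ?mulr0 //.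
  by rewrite rows_cons rows_cat !mem_cat !inE eqxx /= !orbT.
case: ifP => ok zab.
  rewrite (proj1 (hl _ zab)) det_node_eq0 ?mulr0 //.
    by rewrite size_Double size_iota nE.
  by apply: mem_rows_Double; rewrite mem_iota; lia.
apply: gu0 => //; rewrite (proj1 (hu _ zab)) det_node_eq0 ?mulr0 //.
rewrite rows_cons rows_cat !mem_cat mem_rows_Double ?orbT //.
by rewrite mem_iota; lia.
Qed.

Lemma odd_form_alternates (R : realType) (a b : R) n (alpha : 'I_n.+1 -> R) m (f gl gu : R -> R) :
  n = (2 * m + 1)%N -> (forall t, f t = gl t + gu t) ->
  odd_form a b (monomial alpha) m gl gu ->
  (forall t, t \in `[a, b] -> 0 <= gl t <= f t) /\
  exists t : nat -> R, (forall i, (i < n)%N -> t i < t i.+1) /\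
    forall k, (k <= n)%N -> t k \in `[a, b] /\ gl (t k) = if odd (n - k) then 0 else f (t k).
Proof.
move=> nE fE [x [y [cl [cu [so _ _ hl hu]]]]].
split=> [t tab|].
  by rewrite fE lerDl (proj2 (hl _ tab)) (proj2 (hu _ tab)).
have {}nE : n = m.*2.+1 by rewrite nE mul2n addn1.
set L := _ ++ _ in so.
have sL : size L = n.+1 by rewrite !size_cat size_pairs nE /= addn1.
have Lk k : (k <= n)%N -> nth 0 L k =
    if k == 0%N then a else if k == n then b else if odd k then y k.+1./2 else x k./2.
  by rewrite nE; exact: nth_odd_snake.
have Ln : nth 0 L n = b by rewrite Lk // eqxx nE.
have [L1 L2] := sorted_nth_itv so sL (Lk 0%N (leq0n _)) Ln.
exists (nth 0 L); split=> // k kn; split; first exact: L2.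
have on : odd n by rewrite nE /= odd_double.
have := L2 k kn; rewrite Lk // oddB // on addTb.
have gu0 z : gu z = 0 -> gl z = f z by move=> h; rewrite fE h addr0.
have hlz : size (rows ([:: Single a] ++ [seq Double (x i) | i <- iota 1 m])) = n.
  by rewrite !rows_cat !size_cat size_Double size_iota nE.
have huz : size (rows ([seq Double (y i) | i <- iota 1 m] ++ [:: Single b])) = n.
  by rewrite !rows_cat !size_cat size_Double size_iota nE addn1.
case: eqP => [->|k0] /=.
  move=> zab; rewrite (proj1 (hl _ zab)) det_node_eq0 ?mulr0 //.
  by rewrite rows_cons mem_cat inE eqxx.
case: eqP => [->|kn'].
  rewrite on /= => zab; apply: gu0.
  rewrite (proj1 (hu _ zab)) det_node_eq0 ?mulr0 //.
  by rewrite rows_cat mem_cat !inE eqxx /= !orbT.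
case: ifP => ok zab /=.
  apply: gu0; rewrite (proj1 (hu _ zab)) det_node_eq0 ?mulr0 //.
  by rewrite rows_cat mem_cat mem_rows_Double // mem_iota; lia.
rewrite (proj1 (hl _ zab)) det_node_eq0 ?mulr0 //.
by rewrite rows_cons mem_cat mem_rows_Double ?orbT // mem_iota; lia.
Qed.

Theorem theorem5p2p1 (R : realType) (a b : R) (n : nat)
    (alpha : 'I_n.+1 -> R) (coef : 'I_n.+1 -> R) (f : R -> R)
    (ha : 0 < a) (hab : a < b) (hn : (0 < n)%N)
    (halpha : forall i j : 'I_n.+1, (i < j)%N -> alpha i < alpha j)
    (hf : f = (fun t => \sum_(i < n.+1) coef i * t `^ alpha i))
    (hpos : forall t, t \in `[a, b] -> 0 < f t)
    (hlead : 0 < coef ord_max) :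
  exists! d : (R -> R) * (R -> R),
    let: (fl, fu) := d in
    [/\ lin (range (monomial alpha)) fl,
        lin (range (monomial alpha)) fu,
        f = (fun t => fl t + fu t)
      & (exists2 m : nat, n = (2 * m)%N &
           even_form a b (monomial alpha) m fl fu)
        \/
        (exists2 m : nat, n = (2 * m + 1)%N &
           odd_form a b (monomial alpha) m fl fu)].
Proof.
have inc : increasing_upto n.+1 (exponents alpha).
  by move=> i j ij jn; apply: halpha; rewrite !inordK // (ltn_trans ij).
pose fc (i : nat) := coef (inord i).
have fE t : f t = row_eval n.+1 (exponents alpha) fc (0%N, t).
  by rewrite hf; apply: eq_bigr => i _; rewrite /row_entry /fc /exponents /= !inord_val.
have f0 t : t \in `[a, b] -> 0 < row_eval n.+1 (exponents alpha) fc (0%N, t).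
  by rewrite -fE; exact: hpos.
have [c Kc cmax] := exists_max_top ha hab inc (fun t tab => ltW (f0 t tab)).
have cn0 : 0 <= c n.
  apply: (cmax (fun=> 0)) => t tab; rewrite /row_eval big1 ?lexx ?ltW ?f0 // => i _.
  by rewrite mul0r.
have fcn : fc n <= c n by apply: cmax => t tab; rewrite lexx ltW ?f0.
have [u [uS hu]] := exists_alternation ha hab inc f0 Kc cmax.
pose fl t := row_eval n.+1 (exponents alpha) c (0%N, t).
pose fu t := row_eval n.+1 (exponents alpha) (fun i => fc i - c i) (0%N, t).
have fuE t : fu t = f t - fl t.
  by rewrite fE /fu /fl /row_eval -sumrB; apply: eq_bigr => i _; rewrite mulrBl.
exists (fl, fu); split.
  split.
  - by apply/lin_monomialP; exists c.
  - by apply/lin_monomialP; exists (fun i => fc i - c i).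
  - by apply/funext => t; rewrite fuE addrC subrK.
  - exact: (snake_form ha hn inc f0 Kc cn0 fcn uS hu).
move=> [gl gu] [/lin_monomialP[c1 glE] _ fgE forms].
have fg t : f t = gl t + gu t by rewrite fgE.
have [Kg [t [tS ht]]] : (forall t, t \in `[a, b] -> 0 <= gl t <= f t) /\
  exists t : nat -> R, (forall i, (i < n)%N -> t i < t i.+1) /\
    forall k, (k <= n)%N -> t k \in `[a, b] /\ gl (t k) = if odd (n - k) then 0 else f (t k).
  case: forms => [[m nE]|[m nE]]; first exact: even_form_alternates.
  exact: odd_form_alternates.
have cE : forall i, (i < n.+1)%N -> c1 i = c i.
  apply: (alternating_unique (t := t) ha inc Kc tS).
    by move=> k kn; have := ht k kn; rewrite glE fE.
  by apply: cmax => s sab; have := Kg s sab; rewrite glE fE.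
have flg s : fl s = gl s by rewrite glE; apply: eq_bigr => i _; rewrite cE.
congr pair; apply/funext => s //.
by rewrite fuE flg fg addrC addKr.
Qed.
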